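(* Fix a graph $M$. Any graph $G=(V,E,\ell)$ that excludes $M$ as a minor, with a set $T\subset V$ of $k$ terminals, admits an $(\mathcal{O}(1),\ \widetilde{\mathcal{O}}(k^2))$-DAM, where the hidden constants depend only on $M$ and $\widetilde{\mathcal{O}}$ hides factors polylogarithmic in $k$.
   Context: Graphs $G=(V,E,\ell)$ are finite and undirected, with an edge length function $\ell:E\to\mathbb{R}^+$ and a designated set $T\subset V$ of $k$ vertices called terminals; the other vertices are non-terminals. $d_G$ is the shortest-path distance. In the notion of DAM, a minor of $G$ is a graph obtained by a sequence of vertex deletions, edge deletions and edge contractions, where no terminal may be deleted and no two terminals may be contracted together (so every terminal survives; a super-node containing terminal $t$ is identified with $t$); a minor carries its own edge length function $\ell'$. A minor $H=(V',E',\ell')$ of $G$ is an $\alpha$-distance approximating minor ($\alpha$-DAM) of $G$ if $d_G(t,t')\le d_H(t,t')\le\alpha\cdot d_G(t,t')$ for all $t,t'\in T$. It is an $(\alpha,y)$-DAM if in addition it has at most $y$ non-terminals. ''Excludes $M$ as a minor'' is meant in the usual unweighted graph-minor sense (no terminals involved). *)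

(* Defs.v *)
From Stdlib Require Export Relation_Operators.
From mathcomp Require Export all_boot all_order all_algebra.
From mathcomp Require Export classical_sets reals ereal exp.

Set Implicit Arguments.
Unset Strict Implicit.
Unset Printing Implicit Defensive.

Import Order.TTheory GRing.Theory Num.Theory.

Local Open Scope ring_scope.

(* The vertices form a subset of an ambient finite type, so that a minor of a
   graph lives on the same type and surviving terminals keep their names. *)
Record sgraph (V : finType) := SGraph {
  verts : {set V};
  edges : {set {set V}};
  edgesP : [forall e in edges, (e \subset verts) && (#|e| == 2)%N] }.

Definition adj (V : finType) (G : sgraph V) : rel V :=
  fun x y => [set x; y]%SET \in edges G.

Definition iso (V W : finType) (G : sgraph V) (M : sgraph W) : Prop :=
  exists f : W -> V,
    [/\ {in verts M &, injective f},
        verts G = (f @: verts M)%SET &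
        edges G = [set (f @: (e : {set W}))%SET | e in edges M]%SET].

Definition merge_vertices (V : finType) (u v x : V) : V :=
  if x == v then u else x.

(* The super-node obtained by contracting uv is called u. As v must not be a
   terminal, two terminals are never contracted together, and a super-node that
   contains a terminal bears the name of that terminal. The parallel edges
   created by a contraction are identified. *)
Inductive minor_step (V : finType) (T : {set V}) (G H : sgraph V) : Prop :=
| Delete_vertex v of
    v \in verts G & v \notin T &
    verts H = (verts G :\ v)%SET &
    edges H = [set e in edges G | v \notin (e : {set V})]%SET
| Delete_edge e of
    e \in edges G &
    verts H = verts G &
    edges H = (edges G :\ e)%SET
| Contract_edge u v of
    [set u; v]%SET \in edges G & v \notin T &
    verts H = (verts G :\ v)%SET &
    edges H = [set (merge_vertices u v @: (e : {set V}))%SET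
                 | e in (edges G :\ [set u; v])%SET]%SET.

(* [minor T G H]: H is a minor of G with respect to the terminals T. *)
Definition minor (V : finType) (T : {set V}) : sgraph V -> sgraph V -> Prop :=
  clos_refl_trans (sgraph V) (minor_step T).

(* Without terminals, [minor] is the usual minor relation on graphs. *)
Definition excludes_minor (V W : finType) (G : sgraph V) (M : sgraph W) : Prop :=
  ~ exists H : sgraph V, minor finset.set0 G H /\ iso H M.

(* An edge length function is given on all sets of vertices; only its values on
   edges are ever used. *)
Definition positive_lengths (R : realType) (V : finType) (G : sgraph V)
    (ell : {set V} -> R) : Prop :=
  forall e, e \in edges G -> 0 < ell e.

(* The length of the walk x :: p. *)
Definition walk_length (R : realType) (V : finType) (ell : {set V} -> R)
    (x : V) (p : seq V) : R :=
  \sum_(e <- pairmap (fun a b : V => [set a; b]%SET) x p) ell e.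

(* The infimum is +oo when x and y are not connected. *)
Definition dist (R : realType) (V : finType) (G : sgraph V)
    (ell : {set V} -> R) (x y : V) : \bar R :=
  ereal_inf [set d | exists p : seq V,
    [/\ path (adj G) x p, last x p = y & d = (walk_length ell x p)%:E]]%classic.

Definition is_DAM (R : realType) (V : finType) (G : sgraph V)
    (ell : {set V} -> R) (T : {set V}) (alpha : R)
    (H : sgraph V) (ell' : {set V} -> R) : Prop :=
  [/\ minor T G H,
      positive_lengths H ell' &
      forall t t' : V, t \in T -> t' \in T ->
        (dist G ell t t' <= dist H ell' t t')%E /\
        (dist H ell' t t' <= alpha%:E * dist G ell t t')%E].

Definition is_sized_DAM (R : realType) (V : finType) (G : sgraph V)
    (ell : {set V} -> R) (T : {set V}) (alpha : R) (y : nat)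
    (H : sgraph V) (ell' : {set V} -> R) : Prop :=
  is_DAM G ell T alpha H ell' /\ (#|(verts H :\: T)%SET| <= y)%N.

(* [soft_bigO R f g]: f is in O~(g), the hidden factor being polylogarithmic in
   the argument k. The range starts at 2 because ln 1 = 0. *)
Definition soft_bigO (R : realType) (f g : nat -> nat) : Prop :=
  exists (C : R) (c : nat), forall k : nat, (2 <= k)%N ->
    (f k)%:R <= C * (g k)%:R * ln (k%:R : R) ^+ c.

(* Main.v *)
(* Klein, Plotkin and Rao: in a graph without the minor [M], cutting the graph
   repeatedly into strips of width [2 rho] of the distance to a root leaves
   clusters in which fewer than [|W| + 2] vertices are pairwise [O(rho)] apart;
   otherwise the far vertices, prolonged towards the successive roots, would form
   a large complete bipartite minor. With overlapping strips every path of length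
   at most [rho] stays in a cluster, so that linking each terminal to a net of its
   clusters joins all terminals at distance [rho] by two hops. At the scale
   [delta 2^i] it suffices to treat one terminal for each class of terminals
   linked at a scale smaller by a factor [O(k)], and only the classes that merge
   soon; this makes [O(k log k)] pairs in all, which form a spanner of constant
   stretch for the terminal metric.
   Among the minors that preserve the distances of these pairs take a smallest one.
   Its nonterminals have degree at least 3 and each of its edges lies on every
   shortest path of some pair; hence each nonterminal is the first or the last
   vertex that a shortest path of one pair has in common with that of another,
   and their number is at most quadratic in the number of pairs. *)
Require Import Defs.
From mathcomp Require Import boolp ring lra zify.
(* Repeated so that their lemmas take precedence over those of classical_sets. *)
From mathcomp Require Import fintype finset.

Set Implicit Arguments.
Unset Strict Implicit.
Unset Printing Implicit Defensive.

Import Order.TTheory GRing.Theory Num.Theory.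

Local Open Scope ring_scope.

(** * Walks *)

Section Walks.
Variables (R : realType) (V : finType) (ell : {set V} -> R).
Implicit Types (x y z : V) (p q : seq V) (e : rel V) (U A : {set V}) (L : R).

Lemma walk_length_nil x : walk_length ell x [::] = 0.
Proof. by rewrite /walk_length big_nil. Qed.

Lemma walk_length_cons x y p :
  walk_length ell x (y :: p) = ell [set x; y] + walk_length ell y p.
Proof. by rewrite /walk_length /= big_cons. Qed.

Lemma walk_length_cat x p q :
  walk_length ell x (p ++ q)
  = walk_length ell x p + walk_length ell (last x p) q.
Proof.
elim: p x => [|y p IHp] x /=; first by rewrite walk_length_nil add0r.
by rewrite !walk_length_cons IHp addrA.
Qed.

Lemma walk_length_rev x p :
  walk_length ell (last x p) (rev (belast x p)) = walk_length ell x p.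
Proof.
elim: p x => [|y p IHp] x /=; first by rewrite !walk_length_nil.
rewrite rev_cons -cats1 walk_length_cat IHp !walk_length_cons walk_length_nil.
rewrite addr0 addrC; congr (_ + _).
have -> : last (last y p) (rev (belast y p)) = y.
  by case: p {IHp} => [|z p] //=; rewrite rev_cons last_rcons.
by rewrite setUC.
Qed.

Definition pos_rel e := forall x y, e x y -> 0 < ell [set x; y].

Lemma walk_length_ge0 e x p :
  pos_rel e -> path e x p -> 0 <= walk_length ell x p.
Proof.
move=> pe; elim: p x => [|y p IHp] x /=; first by rewrite walk_length_nil.
by case/andP=> /pe exy /IHp; rewrite walk_length_cons; apply: addr_ge0; apply: ltW.
Qed.

Definition within e L x y :=
  exists p, [/\ path e x p, last x p = y & walk_length ell x p <= L].

Lemma within_refl e L x : 0 <= L -> within e L x x.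
Proof. by move=> L0; exists [::]; rewrite walk_length_nil. Qed.

Lemma within_trans e L1 L2 y x z :
  within e L1 x y -> within e L2 y z -> within e (L1 + L2) x z.
Proof.
move=> [p [ep <- lp]] [q [eq <- lq]]; exists (p ++ q).
by rewrite cat_path ep last_cat walk_length_cat lerD.
Qed.

Lemma within_le e L1 L2 x y : L1 <= L2 -> within e L1 x y -> within e L2 x y.
Proof. by move=> L12 [p [ep lp wp]]; exists p; split=> //; apply: le_trans L12. Qed.

Lemma within_sym e L x y : symmetric e -> within e L x y -> within e L y x.
Proof.
move=> se [p [ep <- wp]]; exists (rev (belast x p)); split.
- by rewrite rev_path; apply: sub_path ep => a b; rewrite se.
- by case: p {ep wp} => //= a p; rewrite rev_cons last_rcons.
- by rewrite walk_length_rev.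
Qed.

Lemma within_sub e e' L x y : subrel e e' -> within e L x y -> within e' L x y.
Proof. by move=> ee' [p [ep lp wp]]; exists p; split=> //; apply: sub_path ep. Qed.

Lemma within_edge e x y : e x y -> within e (ell [set x; y]) x y.
Proof.
by move=> exy; exists [:: y]; rewrite /= exy walk_length_cons walk_length_nil addr0.
Qed.

Lemma shorten_walk e x p : pos_rel e -> path e x p ->
  exists q, [/\ path e x q, last x q = last x p, uniq (x :: q) &
                walk_length ell x q <= walk_length ell x p].
Proof.
move=> pe; have [n] := ubnP (size p); elim: n x p => // n IHn x p /ltnSE sp ep.
case: p ep sp => [_ _|y p /=/andP[exy ep] sp]; first by exists [::]; split.
have [q [eq lq uq wq]] := IHn y p sp ep.
have [xq|xq] := boolP (x \in y :: q); last first.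
  exists (y :: q); split=> //=; rewrite ?exy //.
  - by rewrite -/(uniq (y :: q)) xq uq.
  - by rewrite !walk_length_cons lerD2l.
have [q1 [q2 E]] : exists q1 q2, y :: q = q1 ++ x :: q2.
  by case/splitPr: xq => q1 q2; exists q1, q2.
have wq' : walk_length ell x (y :: q) <= walk_length ell x (y :: p).
  by rewrite !walk_length_cons lerD2l.
have eq' : path e x (y :: q) by rewrite /= exy.
have lq' : last x (y :: q) = last y p by [].
move: eq' wq' lq' uq; rewrite E cat_path last_cat /= => /and3P[e1 e2 e3] wq' lq' uq'.
exists q2; split=> //.
- by move: uq'; rewrite cat_uniq => /and3P[].
- apply: le_trans wq'; rewrite walk_length_cat walk_length_cons addrA lerDr.
  by rewrite addr_ge0 ?(walk_length_ge0 pe e1) // ltW // pe.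
Qed.

Lemma shortest_exists e x y : pos_rel e -> connect e x y ->
  exists p, [/\ path e x p, last x p = y, uniq (x :: p) &
    forall q, path e x q -> last x q = y ->
      walk_length ell x p <= walk_length ell x q].
Proof.
move=> pe /connectP[p0 ep0 ->].
have [p1 [ep1 lp1 up1 _]] := shorten_walk pe ep0.
have szu p : uniq (x :: p) -> (size p <= #|V|)%N.
  by move=> /card_uniqP/= sp; apply: leq_trans (max_card [in x :: p]); rewrite sp.
pose F (b : {bseq #|V| of V}) := walk_length ell x b.
pose P (b : {bseq #|V| of V}) :=
  [&& path e x b, last x b == last x p0 & uniq (x :: b)].
have P1 : P (Bseq (szu _ up1)) by rewrite /P /= ep1 lp1 eqxx.
case: (arg_minP F P1) => b /and3P[eb /eqP lb ub] minb.
exists b; split=> // q eq lq.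
have [q' [eq' lq' uq' wq']] := shorten_walk pe eq.
apply: le_trans wq'; apply: (minb (Bseq (szu _ uq'))).
by rewrite /P eq' lq' lq eqxx.
Qed.

Lemma walk_within e x p y z : symmetric e -> pos_rel e -> path e x p ->
  y \in x :: p -> z \in x :: p -> within e (walk_length ell x p) y z.
Proof.
move=> se pe.
have key a q b : path e a q -> b \in a :: q -> within e (walk_length ell a q) a b.
  move=> /[swap]; case/splitPl=> q1 q2 <-; rewrite cat_path => /andP[e1 e2].
  exists q1; split=> //.
  by rewrite walk_length_cat lerDl (walk_length_ge0 pe e2).
move=> ep yp zp; have [p1 [p2 [E ly]]] : exists p1 p2, p = p1 ++ p2 /\ last x p1 = y.
  by case/splitPl: yp => p1 p2 ly; exists p1, p2.
move: ep zp; rewrite E cat_path walk_length_cat -cat_cons mem_cat ly.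
move=> /andP[e1 e2] /orP[] zp.
  apply: within_sym => //; apply: (@within_le _ (walk_length ell x p1)).
    by rewrite lerDl (walk_length_ge0 pe e2).
  have [q1 [q2 [E1 lz]]] : exists q1 q2, p1 = q1 ++ q2 /\ last x q1 = z.
    by case/splitPl: zp => q1 q2 lz; exists q1, q2.
  move: e1 ly; rewrite E1 cat_path last_cat walk_length_cat lz => /andP[f1 f2] <-.
  apply: (@within_le _ (walk_length ell z q2)).
    by rewrite lerDr (walk_length_ge0 pe f1).
  by exists q2.
apply: (@within_le _ (walk_length ell y p2)).
  by rewrite lerDr (walk_length_ge0 pe e1).
by apply: key => //; rewrite inE zp orbT.
Qed.

End Walks.

(** * Minors *)

Lemma set2_inj (V : finType) (a b c d : V) :
  [set a; b] = [set c; d] -> (a = c /\ b = d) \/ (a = d /\ b = c).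
Proof.
move=> E.
have: a \in [set c; d] by rewrite -E set21.
have: b \in [set c; d] by rewrite -E set22.
have: c \in [set a; b] by rewrite E set21.
have: d \in [set a; b] by rewrite E set22.
rewrite !inE.
by do 4![case/orP=> /eqP ?]; subst; auto.
Qed.

Section Graphs.
Variables (V : finType).
Implicit Types (G H : sgraph V) (T : {set V}) (x y u v : V) (e : {set V}).

Lemma edgeP G e : e \in edges G ->
  exists x y, [/\ e = [set x; y], x != y, x \in verts G & y \in verts G].
Proof.
move=> eG; have /andP[sub /cards2P[x [y [xy E]]]] := implyP (forallP (edgesP G) e) eG.
exists x, y; split=> //; apply: (subsetP sub); rewrite E ?set21 ?set22 //.
Qed.

Lemma adj_sym G : symmetric (adj G).
Proof. by move=> x y; rewrite /adj setUC. Qed.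

Lemma adj_neq G x y : adj G x y -> x != y.
Proof.
move=> /edgeP[a [b [E ab _ _]]]; apply: contra_neq ab => xy.
by case: (set2_inj E) => -[<- <-]; rewrite xy.
Qed.

Lemma adj_verts G x y : adj G x y -> x \in verts G.
Proof.
by move=> /edgeP[a [b [E _ aG bG]]]; case: (set2_inj E) => -[-> _].
Qed.

Lemma delete_vertex T G v : v \in verts G -> v \notin T ->
  exists H, [/\ minor_step T G H, verts H = verts G :\ v &
    edges H = [set e in edges G | v \notin e]].
Proof.
move=> vG vT.
have P : [forall e in [set e in edges G | v \notin e],
            (e \subset verts G :\ v) && (#|e| == 2)%N].
  apply/forall_inP => e; rewrite inE => /andP[/edgeP[x [y [-> xy xG yG]]]].
  rewrite !inE negb_or ![v == _]eq_sym => /andP[vx vy].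
  by rewrite cards2 xy andbT; apply/subsetP=> z; rewrite !inE => /orP[]/eqP->; apply/andP.
exists (SGraph P); split=> //=; exact: (Delete_vertex vG vT).
Qed.

Lemma delete_edge T G e : e \in edges G ->
  exists H, [/\ minor_step T G H, verts H = verts G & edges H = edges G :\ e].
Proof.
move=> eG.
have P : [forall f in edges G :\ e, (f \subset verts G) && (#|f| == 2)%N].
  by apply/forall_inP => f /setD1P[_ fG]; have := implyP (forallP (edgesP G) f) fG.
by exists (SGraph P); split=> //=; exact: (Delete_edge T eG).
Qed.

Lemma merge_vertices_neq u v x : u != v -> merge_vertices u v x != v.
Proof. by rewrite /merge_vertices; case: (eqVneq x v). Qed.

Lemma contract_edge T G u v : adj G u v -> v \notin T ->
  exists H, [/\ minor_step T G H, verts H = verts G :\ v &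
    forall x y, adj H x y <-> exists a b, [/\ adj G a b,
      merge_vertices u v a = x, merge_vertices u v b = y & x != y]].
Proof.
move=> uv vT; set m := merge_vertices u v.
pose E := [set (m @: (e : {set V}))%SET | e in (edges G :\ [set u; v])%SET]%SET.
have m2 a b : m @: [set a; b] = [set m a; m b] by rewrite imsetU1 imset_set1.
have minj a b : a != b -> m a = m b -> [set a; b] = [set u; v].
  rewrite /m /merge_vertices; case: (eqVneq a v) => [->|_]; case: (eqVneq b v) => [->|_].
  - by [].
  - by move=> _ <-; rewrite setUC.
  - by move=> _ ->.
  - by move=> /eqP.
have EP x y : [set x; y] \in E <->
    exists a b, [/\ adj G a b, m a = x, m b = y & x != y].
  split=> [/imsetP[e /setD1P[euv eG]]|[a [b [ab <- <- mab]]]]; last first.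
    rewrite -m2; apply/imsetP; exists [set a; b] => //.
    rewrite in_setD1 andbC; apply/andP; split=> //.
    apply: contraNneq mab => /set2_inj.
    by case=> -[-> ->]; rewrite /m /merge_vertices eqxx ?(negPf (adj_neq uv)).
  have [a [b [Ee ab _ _]]] := edgeP eG; rewrite Ee m2.
  have mab : m a != m b by apply: contraNneq euv => /(minj _ _ ab) <-; rewrite Ee.
  rewrite Ee in eG => /set2_inj[] [-> ->]; first by exists a, b.
  by exists b, a; rewrite adj_sym eq_sym.
have P : [forall e in E, (e \subset verts G :\ v) && (#|e| == 2)%N].
  apply/forall_inP=> e eE; have : e \in E by [].
  case/imsetP: eE => f /setD1P[_ /edgeP[a [b [-> _ aG bG]]]] ->; rewrite m2.
  move=> /EP[_ [_ [_ _ _ ne]]]; rewrite cards2 ne andbT.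
  have mG c : c \in verts G -> m c \in verts G :\ v.
    rewrite !inE merge_vertices_neq ?(adj_neq uv) // /m /merge_vertices.
    by case: eqP => // _ _; apply: adj_verts uv.
  by apply/subsetP=> z; rewrite in_set2 => /orP[]/eqP->; apply: mG.
by exists (SGraph P); split=> //; apply: (Contract_edge uv vT).
Qed.

Lemma adj_delete_vertex G H v x y :
  edges H = [set e in edges G | v \notin e] ->
  adj H x y = [&& adj G x y, x != v & y != v].
Proof. by move=> E; rewrite /adj E !inE negb_or ![v == _]eq_sym. Qed.

Lemma minor_step_lt T G H : minor_step T G H ->
  (#|verts H| + #|edges H| < #|verts G| + #|edges G|)%N.
Proof.
case=> [v vG vT -> ->|e eG -> ->|u v uv vT -> ->].
- rewrite (cardsD1 v (verts G)) vG ltnS leq_add2l subset_leq_card //.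
  by apply/subsetP=> e; rewrite inE => /andP[].
- by rewrite (cardsD1 e (edges G)) eG add1n addnS.
- have vG : v \in verts G by rewrite setUC in uv; apply: (adj_verts uv).
  rewrite (cardsD1 v (verts G)) vG ltnS leq_add2l.
  apply: leq_trans (leq_imset_card _ _) _.
  by rewrite subset_leq_card // subsetDl.
Qed.

Definition induced (e : rel V) (U : {set V}) : rel V :=
  fun x y => [&& x \in U, y \in U & e x y].

Definition connected_in (e : rel V) (U : {set V}) :=
  {in U &, forall x y, connect (induced e U) x y}.

Lemma induced_sym (e : rel V) U : symmetric e -> symmetric (induced e U).
Proof. by move=> se x y; rewrite /induced se andbCA. Qed.

End Graphs.

Section Models.
Variables (V W : finType) (M : sgraph W).

Definition model (G : sgraph V) (B : W -> {set V}) : Prop :=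
  [/\ {in verts M, forall w, [/\ B w != set0, B w \subset verts G &
         connected_in (adj G) (B w)]},
      {in verts M &, forall w w', w != w' -> [disjoint B w & B w']} &
      forall w w', adj M w w' ->
        exists x y, [/\ x \in B w, y \in B w' & adj G x y]].

Lemma model_minor (x0 : V) (G : sgraph V) (B : W -> {set V}) :
  model G B -> exists H, minor set0 G H /\ iso H M.
Proof.
have [n] := ubnP (#|verts G| + #|edges G|)%N.
elim: n G B => // n IHn G B /ltnSE sz [B1 B2 B3].
have step H B' : minor_step set0 G H -> model H B' ->
    exists H, minor set0 G H /\ iso H M.
  move=> GH mH; have [|K [HK KM]] := IHn H B' _ mH.
    exact: leq_trans (minor_step_lt GH) sz.
  by exists K; split=> //; apply: rt_trans HK; apply: rt_step.
have [/exists_inP[v vG /forall_inP vB]|allB] :=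
    boolP [exists v in verts G, [forall w in verts M, v \notin B w]].
  have [H [GH HV HE]] := delete_vertex vG (negbT (in_set0 v)).
  apply: (step H B GH); split=> // [w wM|w w' /[dup] wM' /B3[x [y [xB yB xy]]]].
    have [B0 BG Bc] := B1 w wM; have vBw := vB w wM.
    split=> //; first by rewrite HV subsetD1 BG.
    move=> x y xB yB; apply: connect_sub (Bc x y xB yB) => a b /and3P[aB bB ab].
    apply: connect1; rewrite /induced aB bB (adj_delete_vertex _ _ HE) ab /=.
    by apply/andP; split; apply: contraNneq vBw => <-.
  exists x, y; split=> //; rewrite (adj_delete_vertex _ _ HE) xy /=.
  have wM := adj_verts wM'; rewrite adj_sym in wM'; have w'M := adj_verts wM'.
  by apply/andP; split; [apply: contraNneq (vB w wM)|apply: contraNneq (vB w' w'M)] => <-.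
have [/exists_inP[w wM w1]|B1s] := boolP [exists w in verts M, (1 < #|B w|)%N].
  have [B0 BG Bc] := B1 w wM.
  have [x [y [xB yB xy]]] := card_gt1P w1.
  have /connectP[[|v p] /= ep lp] := Bc x y xB yB; first by rewrite lp eqxx in xy.
  have {ep p lp} /andP[/and3P[_ vB xv] _] := ep.
  have [H [GH HV HE]] := contract_edge xv (negbT (in_set0 v)).
  pose B' w := B w :\ v.
  set m := merge_vertices x v in HE.
  have nxv := adj_neq xv.
  have vw' w' : w' \in verts M -> v \in B w' -> w' = w.
    move=> w'M vBw'; apply/eqP; apply: contraTT vBw' => /(B2 _ _ w'M wM).
    by rewrite disjoint_sym => /disjointFr ->.
  have mB w' a : w' \in verts M -> a \in B w' -> m a \in B' w'.
    move=> w'M aB; rewrite !inE merge_vertices_neq //= /m /merge_vertices.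
    by case: eqP => // av; rewrite av in aB; rewrite (vw' _ w'M aB).
  have madj a b : adj G a b -> m a != m b -> adj H (m a) (m b).
    by move=> ab mab; apply/HE; exists a, b.
  apply: (step H B' GH); split.
  - move=> w' w'M; have [B'0 B'G B'c] := B1 w' w'M; split.
    + by have /set0Pn[a aB] := B'0; apply/set0Pn; exists (m a); apply: mB.
    + by rewrite HV setSD.
    + move=> a b /setD1P[av aB] /setD1P[bv bB].
      have mid c : c != v -> m c = c by rewrite /m /merge_vertices => /negPf->.
      rewrite -(mid a av) -(mid b bv).
      have /connectP[p ep ->] := B'c a b aB bB.
      elim: p a ep {aB av} => [|c p IHp] a /=; first by rewrite connect0.
      case/andP=> /and3P[aB cB ac] /IHp; apply: connect_trans.
      have [->|ne] := eqVneq (m a) (m c); first exact: connect0.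
      by apply: connect1; rewrite /induced !mB // madj.
  - move=> w1' w2' w1M w2M ne; have := B2 _ _ w1M w2M ne.
    by apply: disjointW; apply: subsetDl.
  - move=> w1' w2' ww; have [a [b [aB bB ab]]] := B3 _ _ ww.
    have w1M := adj_verts ww; have nww := adj_neq ww.
    rewrite adj_sym in ww; have w2M := adj_verts ww.
    exists (m a), (m b); split; [exact: mB|exact: mB|apply: madj => //].
    apply: contraTneq (mB _ _ w1M aB) => ->.
    have := mB _ _ w2M bB; rewrite !inE => /andP[_ mbB].
    by rewrite (disjointFl (B2 _ _ w1M w2M nww) mbB) andbF.
have Bf w : w \in verts M -> exists v, B w = [set v].
  move=> wM; apply/cards1P; rewrite eqn_leq card_gt0; have [-> _ _] := B1 w wM.
  by move/exists_inPn: B1s => /(_ w wM); rewrite -leqNgt andbT.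
pose f w := odflt x0 [pick v in B w].
have Bfw w : w \in verts M -> B w = [set f w].
  move=> wM; have [v E] := Bf w wM; rewrite /f E.
  by case: pickP => [u|/(_ v)]; rewrite inE ?eqxx // => /eqP ->.
have finj : {in verts M &, injective f}.
  move=> w w' wM w'M ff; apply/eqP; apply: contraT => /(B2 _ _ wM w'M).
  by rewrite !Bfw // ff -setI_eq0 setIid => /eqP/setP/(_ (f w')); rewrite !inE eqxx.
have fV : verts G = f @: verts M.
  apply/eqP; rewrite eqEsubset; apply/andP; split; apply/subsetP => v.
    move=> vG; move/exists_inPn: allB => /(_ v vG) /forall_inPn[w wM].
    by rewrite negbK Bfw // => /set1P ->; exact: imset_f.
  case/imsetP=> w wM ->; have [_ /subsetP BG _] := B1 w wM; apply: BG.
  by rewrite Bfw // set11.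
pose E := [set (f @: (e : {set W}))%SET | e in edges M]%SET.
have EG : E \subset edges G.
  apply/subsetP=> _ /imsetP[e eM ->]; have [a [b [Ee ab aM bM]]] := edgeP eM.
  rewrite Ee in eM *; have [x [y [xB yB xy]]] := B3 _ _ eM.
  by move: xB yB xy; rewrite !Bfw // => /set1P-> /set1P->; rewrite imsetU1 imset_set1.
have [GE|/subsetPn[e eG eE]] := boolP (edges G \subset E).
  exists G; split; first exact: rt_refl.
  by exists f; split=> //; apply/eqP; rewrite eqEsubset GE.
have [H [GH HV HE]] := delete_edge set0 eG.
apply: (step H B GH); split=> // [w wM|w w' ww].
  have [B0 BG Bc] := B1 w wM; split=> //; rewrite ?HV //.
  by rewrite Bfw // => x y /set1P-> /set1P->; apply: connect0.
have [x [y [xB yB xy]]] := B3 _ _ ww; exists x, y; split=> //.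
have wM := adj_verts ww; have := ww; rewrite adj_sym => /adj_verts w'M.
rewrite /adj HE in_setD1 andbC; apply/andP; split=> //.
apply: contraNneq eE => <-; apply/imsetP; exists [set w; w'] => //.
by move: xB yB; rewrite !Bfw // => /set1P-> /set1P->; rewrite imsetU1 imset_set1.
Qed.

End Models.

(** * Strips and clusters *)

Section Depth.
Variables (R : realType) (V : finType) (ell : {set V} -> R) (e : rel V).
Hypotheses (e_sym : symmetric e) (e_pos : pos_rel ell e).
Implicit Types (x y z : V) (p q : seq V) (U A : {set V}) (D : V -> R).

Definition descends U D : rel V :=
  fun y z => induced e U y z && (D z == D y + ell [set y; z]).

Definition is_depth U x D :=
  [/\ D x = 0,
      forall y z, induced e U y z -> D z <= D y + ell [set y; z] &
      forall y, y \in U -> exists2 p, path (descends U D) x p & last x p = y].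

Lemma induced_pos U : pos_rel ell (induced e U).
Proof. by move=> x y /and3P[_ _ /e_pos]. Qed.

Lemma depth_exists U x : connected_in e U -> x \in U -> exists D, is_depth U x D.
Proof.
move=> Uc xU; set f := induced e U.
have fpos := @induced_pos U.
have /choice[P HP] : forall y, exists p, y \in U ->
   [/\ path f x p, last x p = y & forall q, path f x q -> last x q = y ->
      walk_length ell x p <= walk_length ell x q].
  move=> y; have [yU|yU] := boolP (y \in U); last by exists [::].
  by have [p [? ? _ ?]] := shortest_exists fpos (Uc x y xU yU); exists p.
pose D y := walk_length ell x (P y).
have Dstep y z : f y z -> D z <= D y + ell [set y; z].
  move=> /[dup] fyz /and3P[yU zU _]; have [ey ly _] := HP y yU.
  have [_ _ /(_ (rcons (P y) z))] := HP z zU; rewrite rcons_path ey ly last_rcons.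
  by rewrite -cats1 walk_length_cat ly walk_length_cons walk_length_nil addr0; apply.
have Dx : D x = 0.
  have [ex _ /(_ [::] isT erefl)] := HP x xU; rewrite walk_length_nil => le0.
  by apply/eqP; rewrite eq_le le0 (walk_length_ge0 fpos ex).
exists D; split=> // y yU; exists (P y); last by have [] := HP y yU.
have [ey ly _] := HP y yU.
suff H p q z : P y = p ++ q -> z = last x p -> D z = walk_length ell x p ->
    path (descends U D) z q.
  by apply: (H [::] (P y)); rewrite ?walk_length_nil.
elim: q p z => [|a q IHq] p z //= E zE Dz.
have := ey; rewrite E cat_path /= -zE => /and3P[ep fza eq].
have Da : D a = D z + ell [set z; a].
  apply/eqP; rewrite eq_le Dstep //=.
  have lq : D y <= D a + walk_length ell a q.
    have la : last a q = y by rewrite -ly E last_cat.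
    clear E IHq; elim: q a eq la {fza} => [|b q IHq] a /=.
      by move=> _ <-; rewrite walk_length_nil addr0.
    move=> /andP[fab eq] la; rewrite walk_length_cons addrA.
    by apply: le_trans (IHq b eq la) _; rewrite lerD2r Dstep.
  move: lq; rewrite {1}/D E walk_length_cat walk_length_cons -zE -Dz.
  by rewrite addrA lerD2r.
rewrite /descends -/f fza Da eqxx /=; apply: (IHq (rcons p a)).
- by rewrite cat_rcons.
- by rewrite last_rcons.
- by rewrite Da Dz -cats1 walk_length_cat -zE walk_length_cons walk_length_nil addr0.
Qed.

Section Descending.
Variables (U : {set V}) (x : V) (D : V -> R).
Hypothesis Dx : is_depth U x D.
Local Notation des := (descends U D).

Lemma des_sub : subrel des e.
Proof. by move=> y z /andP[/and3P[]]. Qed.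

Lemma des_lt y z : des y z -> D y < D z.
Proof. by move=> /andP[/and3P[_ _ /e_pos h] /eqP ->]; rewrite ltrDl. Qed.

Lemma des_length y p : path des y p -> walk_length ell y p = D (last y p) - D y.
Proof.
elim: p y => [|z p IHp] y /=; first by rewrite walk_length_nil subrr.
by case/andP=> /andP[_ /eqP E] /IHp; rewrite walk_length_cons E => ->; lra.
Qed.

Lemma des_min y p z : path des y p -> z \in y :: p -> D y <= D z.
Proof.
elim: p y => [|a p IHp] y /=; first by rewrite inE => _ /eqP->.
case/andP=> /des_lt ya /IHp{}IHp; rewrite inE => /orP[/eqP->//|/IHp].
by apply: le_trans; apply: ltW.
Qed.

Lemma des_sub_set y p z : y \in U -> path des y p -> z \in y :: p -> z \in U.
Proof.
elim: p y => [|a p IHp] y yU /=; first by rewrite inE => _ /eqP->.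
case/andP=> /andP[/and3P[_ aU _] _] /(IHp a aU){}IHp.
by rewrite inE => /orP[/eqP->//|/IHp].
Qed.

Lemma des_split y p c : path des y p -> D y < c -> c <= D (last y p) ->
  exists p1 a p2, [/\ p = p1 ++ a :: p2, (forall z, z \in y :: p1 -> D z < c),
    (forall z, z \in a :: p2 -> c <= D z) &
    [/\ path des y p1, des (last y p1) a & path des a p2]].
Proof.
elim: p y => [|a p IHp] y /=; first by move=> _ h1 h2; lra.
case/andP=> ya ap yc cl; have [ac|ca] := ltP (D a) c; last first.
  exists [::], a, p; split=> // z.
    by rewrite inE => /eqP->.
  by move/(des_min ap); apply: le_trans.
have [p1 [b [p2 [-> H1 H2 [e1 ab e2]]]]] := IHp a ap ac cl.
exists (a :: p1), b, p2; split=> //=; last by rewrite ya.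
by move=> z; rewrite inE => /orP[/eqP->//|/H1].
Qed.

Lemma depth_le y z L : within ell (induced e U) L y z -> D z <= D y + L.
Proof.
case=> p [ep <- le]; suff : D (last y p) <= D y + walk_length ell y p by lra.
have [_ Dst _] := Dx; elim: p y ep {le} => [|a p IHp] y /=.
  by rewrite walk_length_nil addr0.
by case/andP=> /Dst ya /IHp; rewrite walk_length_cons; lra.
Qed.

Lemma depth_ge0 y : y \in U -> 0 <= D y.
Proof.
have [D0 _ P] := Dx => /P[p ep <-]; rewrite -D0.
by apply: (des_min ep); rewrite mem_last.
Qed.

End Descending.

Lemma path_connected y p : path e y p -> connected_in e [set q in y :: p].
Proof.
move=> ep; set A := [set _ in _].
suff H z : z \in A -> connect (induced e A) y z.
  move=> a b /H ya /H; apply: connect_trans.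
  by rewrite (sym_connect_sym (induced_sym _ e_sym)).
rewrite inE => zp; have [p1 [p2 [E lz]]] : exists p1 p2, p = p1 ++ p2 /\ last y p1 = z.
  by case/splitPl: zp => p1 p2 lz; exists p1, p2.
rewrite E cat_path in ep; case/andP: ep => ep _.
rewrite -lz; apply/connectP; exists p1 => //.
have sub : {subset y :: p1 <= A}.
  by move=> a; rewrite !inE E mem_cat => /orP[->//|->]; rewrite orbT.
elim: p1 (y) ep sub {E lz} => [|b p1 IHp] a //= /andP[ab ep] sub.
rewrite IHp // ?andbT.
  by rewrite /induced ab !sub ?inE ?eqxx ?orbT.
by move=> c cp; apply: sub; rewrite inE cp orbT.
Qed.

Definition band D (rho : R) n U := [set y in U | n%:R * rho <= D y < (n + 2)%:R * rho].

Definition component U x := [set y in U | connect (induced e U) x y].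

Lemma component_connected U x : connected_in e (component U x).
Proof.
move=> a b; rewrite !inE => /andP[aU xa] /andP[bU xb].
have /connectP[p ep ->] : connect (induced e U) a b.
  by apply: connect_trans xb; rewrite (sym_connect_sym (induced_sym _ e_sym)).
apply/connectP; exists p => //; elim: p a aU xa ep => //= c p IHp a aU xa.
case/andP=> ac ep; have /and3P[_ cU ac'] := ac.
have xc := connect_trans xa (connect1 ac).
by rewrite IHp // andbT /induced !inE aU xa cU xc.
Qed.

(* The path from [h] up towards the root [x] leaves the band of [h]; it is cut
   at depth [(n - 6) rho], its lower part containing a new head [h'] at depth
   about [(n - 3) rho], far from the upper part and from the band. *)
Lemma root_path (rho : R) U x D n h :
  0 < rho -> (forall a b, e a b -> ell [set a; b] <= rho) ->
  x \in U -> is_depth U x D -> (6 < n)%N -> h \in band D rho n U ->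
  exists (T B : {set V}) (h' : V),
  [/\ [/\ T \subset U, connected_in e T, h \in T & h' \in T],
      [/\ B \subset U, connected_in e B, x \in B &
         exists a b, [/\ a \in T, b \in B & e a b]],
      [/\ (forall q : V, q \in T -> (n%:R - 6) * rho <= D q),
          (forall q : V, q \in B -> D q < (n%:R - 6) * rho) &
          (n%:R - 4) * rho <= D h' < (n%:R - 3) * rho],
      (forall q : V, q \in T -> within ell e (D h - D q) q h) &
      forall q : V, q \in T -> n%:R * rho <= D q ->
        q \in component (band D rho n U) h /\
        within ell (induced e (component (band D rho n U)  h)) (D h - D q) h q].
Proof.
move=> rho0 short xU Dx n6; rewrite inE => /and3P[hU Dh1 Dh2].
have n7 : 7 <= n%:R :> R by rewrite (ler_nat _ 7).
have [D0 _ P] := Dx.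
have [p ep lp] := P h hU.
have [p1 [a [p2 [Ep H1 H2 [ep1 d1 ep2]]]]] : exists p1 a p2,
  [/\ p = p1 ++ a :: p2, (forall z, z \in x :: p1 -> D z < (n%:R - 6) * rho),
    (forall z, z \in a :: p2 -> (n%:R - 6) * rho <= D z) &
    [/\ path (descends U D) x p1, descends U D (last x p1) a &
        path (descends U D) a p2]].
  by apply: des_split => //; rewrite ?D0 ?lp; nra.
have la : last a p2 = h by rewrite -lp Ep last_cat.
have aU : a \in U by case/andP: d1 => /and3P[].
have step y z : descends U D y z -> D z <= D y + rho.
  by move=> /[dup] /des_sub /short yz /andP[_ /eqP ->]; rewrite lerD2l.
have Da := H2 a (mem_head _ _).
have Da' : D a < (n%:R - 5) * rho.
  by have := H1 _ (mem_last x p1); have := step _ _ d1; nra.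
have [p3 [b [p4 [Ep2 H3 H4 [ep3 d3 ep4]]]]] : exists p3 b p4,
  [/\ p2 = p3 ++ b :: p4, (forall z, z \in a :: p3 -> D z < (n%:R - 3) * rho),
    (forall z, z \in b :: p4 -> (n%:R - 3) * rho <= D z) &
    [/\ path (descends U D) a p3, descends U D (last a p3) b &
        path (descends U D) b p4]].
  by apply: des_split => //; rewrite ?la; nra.
exists [set q in a :: p2], [set q in x :: p1], (last a p3).
split.
- split.
  + by apply/subsetP=> z; rewrite in_set; apply: des_sub_set ep2.
  + by apply: path_connected; apply: sub_path ep2; apply: des_sub.
  + by rewrite in_set -la mem_last.
  + by rewrite in_set Ep2 -cat_cons mem_cat mem_last.
- split.
  + by apply/subsetP=> z; rewrite in_set; apply: des_sub_set ep1.
  + by apply: path_connected; apply: sub_path ep1; apply: des_sub.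
  + by rewrite in_set mem_head.
  + exists a, (last x p1); rewrite !in_set mem_last mem_head; split=> //.
    by rewrite e_sym (des_sub d1).
- split.
  + by move=> q; rewrite in_set; apply: H2.
  + by move=> q; rewrite in_set; apply: H1.
  + rewrite (H3 _ (mem_last _ _)) andbT.
    by have := H4 b (mem_head _ _); have := step _ _ d3; nra.
- move=> q; rewrite in_set => qp.
  have [q1 [q2 [E lq]]] : exists q1 q2, p2 = q1 ++ q2 /\ last a q1 = q.
    by case/splitPl: qp => q1 q2 lq; exists q1, q2.
  move: ep2; rewrite E cat_path lq => /andP[_ eq2].
  have lq2 : last q q2 = h by rewrite -la E last_cat lq.
  exists q2; split=> //; last by rewrite (des_length eq2) lq2.
  by apply: sub_path eq2; apply: des_sub.
- move=> q; rewrite in_set => qp Dq.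
  have [q1 [q2 [E lq]]] : exists q1 q2, p2 = q1 ++ q2 /\ last a q1 = q.
    by case/splitPl: qp => q1 q2 lq; exists q1, q2.
  have qU : q \in U by apply: des_sub_set ep2 _.
  move: ep2; rewrite E cat_path lq => /andP[_ eq2].
  have lq2 : last q q2 = h by rewrite -la E last_cat lq.
  set C := band D rho n U.
  have eC : path (induced e C) q q2.
    elim: q2 q Dq qU eq2 lq2 {E lq qp} => //= c q2 IHq q Dq qU /andP[qc eq2] lc.
    have cU : c \in U by case/andP: qc => /and3P[].
    have qlc := des_lt qc.
    have cl : D c <= D h by rewrite -lc; apply: (des_min eq2); rewrite mem_last.
    rewrite IHq // ?andbT; last by lra.
    by rewrite /induced !inE qU cU (des_sub qc); lra.
  have hq : connect (induced e C) h q.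
    rewrite (sym_connect_sym (induced_sym _ e_sym)).
    by apply/connectP; exists q2.
  have Cq : q \in component C h.
    rewrite inE hq andbT inE qU Dq /=.
    suff : D q <= D h by lra.
    by rewrite -lq2; apply: (des_min eq2); rewrite mem_last.
  split=> //; apply: within_sym; first exact: induced_sym.
  exists q2; split=> //; last by rewrite (des_length eq2) lq2.
  elim: q2 q hq Cq eC {eq2 lq2 Dq qU qp E lq} => //= c q2 IHq q hq Cq /andP[qc eC].
  have hc := connect_trans hq (connect1 qc).
  have Cc : c \in component C h by rewrite inE hc andbT; case/and3P: qc.
  by rewrite IHq // andbT /induced Cq Cc; case/and3P: qc.
Qed.

End Depth.

Lemma connect_inducedS (V : finType) (e : rel V) (A B : {set V}) x y :
  A \subset B -> connect (induced e A) x y -> connect (induced e B) x y.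
Proof.
move=> /subsetP AB; apply: connect_sub => a b /and3P[/AB aB /AB bB ab].
by apply: connect1; rewrite /induced aB bB.
Qed.

Lemma connected_star (V : finType) (e : rel V) (A : {set V}) x : symmetric e ->
  (forall z, z \in A -> connect (induced e A) x z) -> connected_in e A.
Proof.
move=> se H a b /H xa /H; apply: connect_trans.
by rewrite (sym_connect_sym (induced_sym _ se)).
Qed.

Lemma connected_bigU (V I : finType) (e : rel V) (F : I -> {set V}) x :
  symmetric e -> (forall i, connected_in e (F i)) -> (forall i, x \in F i) ->
  connected_in e (\bigcup_i F i).
Proof.
move=> se Fc Fx; apply: (@connected_star _ _ _ x) => // z /bigcupP[i _ zi].
by apply: connect_inducedS (Fc i x z (Fx i) zi); apply: bigcup_sup.
Qed.

Lemma connectedU (V : finType) (e : rel V) (A B : {set V}) x :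
  symmetric e -> connected_in e A -> connected_in e B -> x \in A -> x \in B ->
  connected_in e (A :|: B).
Proof.
move=> se Ac Bc xA xB; apply: (@connected_star _ _ _ x) => // z /setUP[] zX.
  by apply: connect_inducedS (Ac x z xA zX); apply: subsetUl.
by apply: connect_inducedS (Bc x z xB zX); apply: subsetUr.
Qed.

Lemma card_bigcup_le (I T : finType) (A : {pred I}) (F : I -> {set T}) :
  (#|\bigcup_(i in A) F i| <= \sum_(i in A) #|F i|)%N.
Proof.
elim/big_rec2: _ => [|i m S _ IH]; first by rewrite cards0.
by apply: leq_trans (leq_card_setU _ _) _; rewrite leq_add2l.
Qed.

Section Clusters.
Variables (R : realType) (V : finType) (ell : {set V} -> R) (e : rel V).
Hypotheses (e_sym : symmetric e) (e_pos : pos_rel ell e).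
Variable rho : R.
Hypotheses (rho_gt0 : 0 < rho) (e_short : forall a b, e a b -> ell [set a; b] <= rho).
Variable depth : {set V} -> V -> R.
Hypothesis depthP : forall U, U != set0 -> connected_in e U ->
  exists2 x, x \in U & is_depth ell e U x (depth U).
Implicit Types (x y z u v : V) (U C : {set V}).

Local Notation strip U n := (band (depth U) rho n U).

Definition strip_index U v := Num.truncn (depth U v / rho).

Fixpoint clusters j v : {set {set V}} :=
  if j is j'.+1 then
    \bigcup_(U in clusters j' v)
      [set component e (strip U (strip_index U v)) v;
           component e (strip U (strip_index U v).-1) v]
  else [set component e setT v].

Lemma clusters_card j v : (#|clusters j v| <= 2 ^ j)%N.
Proof.
elim: j => [|j IHj] /=; first by rewrite cards1.
apply: leq_trans (card_bigcup_le _ _) _.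
rewrite expnSr; apply: leq_trans (leq_mul IHj (leqnn 2)).
rewrite -sum_nat_const; apply: leq_sum => U _.
by apply: leq_trans (leq_card_setU _ _) _; rewrite !cards1.
Qed.

Lemma strip_indexP U n v : connected_in e U -> v \in U ->
  (v \in strip U n) = (n == strip_index U v) || (n == (strip_index U v).-1).
Proof.
move=> Uc vU; have U0 : U != set0 by apply/set0Pn; exists v.
have [x xU Dx] := depthP U0 Uc.
have D0 : 0 <= depth U v / rho.
  by rewrite divr_ge0 ?(ltW rho_gt0) // (depth_ge0 e_pos Dx vU).
rewrite inE vU /= -ler_pdivlMr // -ltr_pdivrMr // /strip_index.
rewrite -truncn_ge_nat // -truncn_lt_nat //; move: (Num.truncn _) => t; lia.
Qed.

Lemma component_self U v : v \in U -> v \in component e U v.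
Proof. by move=> vU; rewrite inE vU connect0. Qed.

Lemma component_eq U u v : u \in component e U v -> component e U u = component e U v.
Proof.
rewrite inE => /andP[uU vu]; apply/setP=> z; rewrite !inE; congr (_ && _).
by rewrite (same_connect (sym_connect_sym (induced_sym _ e_sym)) vu).
Qed.

Lemma clusters_self j v U : U \in clusters j v -> v \in U /\ connected_in e U.
Proof.
elim: j U => [|j IHj] U /=.
  by move/set1P->; split; [apply: component_self|apply: component_connected].
case/bigcupP=> C /IHj[vC Cc] UC.
have [n -> nC] : exists2 n, U = component e (strip C n) v & v \in strip C n.
  by case/set2P: UC => ->; eexists; rewrite // strip_indexP // eqxx ?orbT.
by split; [apply: component_self|apply: component_connected].
Qed.

Lemma clusters_mem j u v U : U \in clusters j v -> u \in U -> U \in clusters j u.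
Proof.
elim: j U => [|j IHj] U /=.
  by move/set1P-> => /component_eq <-; rewrite set11.
case/bigcupP=> C Cv UC uU; have [vC Cc] := clusters_self Cv.
have [n E] : exists n, U = component e (strip C n) v.
  by case/set2P: UC => ->; eexists.
rewrite E in uU *; have uC : u \in strip C n by move: uU; rewrite inE => /andP[].
have uC' : u \in C by move: uC; rewrite inE => /andP[].
apply/bigcupP; exists C; first exact: IHj.
rewrite -(component_eq uU) !inE; rewrite strip_indexP // in uC.
by case/orP: uC => /eqP ->; rewrite eqxx ?orbT.
Qed.

Lemma clusters_walk j x p : path e x p -> walk_length ell x p <= rho ->
  exists2 U, U \in clusters j x & {subset x :: p <= U}.
Proof.
move=> ep lp.
have subC C q y : path e y q -> {subset y :: q <= C} ->
    path (induced e C) y q /\ {subset y :: q <= component e C y}.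
  move=> eq sC; have iq : path (induced e C) y q.
    elim: q y eq sC => //= a q IHq y /andP[ya eq] sC.
    rewrite IHq // ?andbT; last by move=> z zq; apply: sC; rewrite inE zq orbT.
    by rewrite /induced ya !sC // ?inE eqxx ?orbT.
  split=> // z zq; rewrite inE sC //=; case/splitPl: zq iq => q1 q2 <-.
  by rewrite cat_path => /andP[iq _]; apply/connectP; exists q1.
elim: j => [|j [U Ux sU]] /=.
  exists (component e setT x); first by rewrite set11.
  have sT : {subset x :: p <= [set: V]} by move=> z _; rewrite inE.
  by have [] := subC _ _ _ ep sT.
have [xU Uc] := clusters_self Ux.
have U0 : U != set0 by apply/set0Pn; exists x.
have [r rU Dr] := depthP U0 Uc.
have [ip _] := subC U p x ep sU.
have xp : x \in x :: p by rewrite mem_head.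
have pos := @induced_pos _ _ _ _ e_pos U.
pose P := [pred z | z \in x :: p].
case: (@arg_minP _ _ _ x P (depth U) xp) => z zp zmin.
have near u : u \in x :: p -> depth U u <= depth U z + rho.
  move=> up; apply: (depth_le Dr); apply: within_le lp _.
  exact: (walk_within (induced_sym _ e_sym) pos ip).
have zU : z \in U by apply: sU.
have D0 : 0 <= depth U z / rho.
  by rewrite divr_ge0 ?(ltW rho_gt0) // (depth_ge0 e_pos Dr zU).
pose n := strip_index U z.
have sn : {subset x :: p <= strip U n}.
  move=> u up; rewrite inE sU //= /n /strip_index.
  have /andP[h1 h2] := truncn_itv D0; have := zmin u up; have := near u up.
  move: h1 h2; rewrite ler_pdivlMr // ltr_pdivrMr //.
  by rewrite addn2 -natr1; rewrite -[_.+1%:R]natr1; nra.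
exists (component e (strip U n) x); last by have [] := subC _ _ _ ep sn.
apply/bigcupP; exists U => //.
have := sn x xp; rewrite strip_indexP // => /orP[]/eqP ->; first exact: set21.
exact: set22.
Qed.

(* [r] disjoint connected sets [A i] and [m] disjoint connected sets [B l] form
   a complete bipartite minor; each [A i] has a head [h i] that is far from the
   other heads in the whole graph, and inside [U] from all the other sets. *)
Record spread_model (r : nat) U m (d : R)
    (A : 'I_r -> {set V}) (B : nat -> {set V}) (h : 'I_r -> V) : Prop := {
  sm_A : forall i, [/\ A i \subset U, connected_in e (A i) & h i \in A i];
  sm_B : forall l, (l < m)%N -> B l \subset U /\ connected_in e (B l);
  sm_adj : forall i l, (l < m)%N -> exists a b, [/\ a \in A i, b \in B l & e a b];
  sm_AA : forall i i', i != i' -> [disjoint A i & A i'];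
  sm_BB : forall l l', (l < l' < m)%N -> [disjoint B l & B l'];
  sm_AB : forall i l, (l < m)%N -> [disjoint A i & B l];
  sm_far : forall i i', i != i' -> ~ within ell e d (h i) (h i');
  sm_hA : forall i i' a, i != i' -> a \in A i' ->
    ~ within ell (induced e U) (2 * rho) (h i) a;
  sm_hB : forall i l b, (l < m)%N -> b \in B l ->
    ~ within ell (induced e U) (2 * rho) (h i) b }.

Lemma spread_model_step r U n v m d A B h :
  (1 < r)%N -> connected_in e U -> v \in strip U n -> 16 * rho <= d ->
  @spread_model r (component e (strip U n) v) m d A B h ->
  exists A' B' h', @spread_model r U m.+1 (d - 12 * rho) A' B' h'.
Proof.
move=> r1 Uc vC d16 S; set D := depth U in vC S *; set C := component e _ v in S *.
have vU : v \in U by move: vC; rewrite inE => /andP[].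
have U0 : U != set0 by apply/set0Pn; exists v.
have [x xU Dx] := depthP U0 Uc; rewrite -/D in Dx.
have CD y : y \in C -> [/\ y \in band D rho n U, y \in U, n%:R * rho <= D y &
    D y < (n + 2)%:R * rho].
  rewrite inE => /andP[yC _]; by have := yC; rewrite inE => /and3P[? ? ?]; split=> //; apply/and3P.
have hC i : h i \in C by have [/subsetP A_C _ /A_C] := sm_A S i.
have Ch i : component e (band D rho n U) (h i) = C by apply: component_eq.
have n6 : (6 < n)%N.
  rewrite ltnNge; apply/negP=> n6.
  have root i : within ell e (8 * rho) x (h i).
    have [D0 _ /(_ (h i))] := Dx; have [_ hU _ Dh] := CD _ (hC i).
    case=> // p ep lp; exists p; split=> //; first by apply: sub_path ep; apply: des_sub.
    rewrite (des_length ep) lp D0 subr0; apply: ltW; apply: lt_le_trans Dh _.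
    by rewrite ler_pM2r // (ler_nat _ (n + 2) 8); lia.
  pose i0 := Ordinal (ltnW r1); pose i1 := Ordinal r1.
  apply: (sm_far S (i := i0) (i' := i1) isT).
  apply: within_le d16 _; have -> : 16 * rho = 8 * rho + 8 * rho by lra.
  by apply: within_trans (root i1); apply: within_sym.
have hs i : h i \in band D rho n U by have [] := CD _ (hC i).
have /choice[T HT] := fun i => root_path e_sym e_pos rho_gt0 e_short xU Dx n6 (hs i).
have /choice[Bt {}HT] := HT; have /choice[h' {}HT] := HT.
exists (fun i => A i :|: T i), (fun l => if l == m then \bigcup_i Bt i else B l), h'.
have rho0 := rho_gt0.
have CU : C \subset U by apply/subsetP=> y /CD[].
have Tlow i q : q \in T i -> (n%:R - 6) * rho <= D q.
  by have [_ _ [H _ _] _ _] := HT i; apply: H.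
have Bhigh i q : q \in Bt i -> D q < (n%:R - 6) * rho.
  by have [_ _ [_ H _] _ _] := HT i; apply: H.
have Clow q : q \in C -> n%:R * rho <= D q by move=> /CD[].
have hDC i : D (h i) < (n%:R + 2) * rho by have [_ _ _] := CD _ (hC i); rewrite natrD.
have Th i q : q \in T i -> within ell e (8 * rho) (h i) q.
  move=> qT; apply: within_sym => //; have [_ _ _ H _] := HT i.
  by apply: within_le (H q qT); have := Tlow _ _ qT; have := hDC i; nra.
have h'D i : (n%:R - 4) * rho <= D (h' i) < (n%:R - 3) * rho.
  by have [_ _ [_ _ H] _ _] := HT i.
have hh' i : within ell e (6 * rho) (h' i) (h i).
  have [[_ _ _ h'T] _ _ H _] := HT i.
  by apply: within_le (H _ h'T); have := h'D i; have := hDC i; nra.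
have TC i q : q \in T i -> q \in C ->
    within ell (induced e C) (2 * rho) (h i) q.
  move=> qT qC; have [_ _ _ _ H] := HT i.
  have [_] := H q qT (Clow _ qC); rewrite Ch; apply: within_le.
  by have := Clow _ qC; have := hDC i; nra.
have far16 i i' : i != i' -> ~ within ell e (16 * rho) (h i) (h i').
  by move=> ii' /(within_le d16); apply: sm_far S _ _ ii'.
have TT i i' q : i != i' -> q \in T i -> q \notin T i'.
  move=> ii' qT; apply/negP=> qT'; apply: (far16 i i' ii').
  have -> : 16 * rho = 8 * rho + 8 * rho by lra.
  by apply: within_trans (Th _ _ qT) _; apply: within_sym (Th _ _ qT').
have TA i i' q : i != i' -> q \in T i -> q \notin A i'.
  move=> ii' qT; apply/negP=> qA; apply: (sm_hA S ii' qA); apply: TC => //.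
  by have [/subsetP A_C _ _] := sm_A S i'; apply: A_C.
have mE l : (l < m.+1)%N -> l = m \/ (l < m)%N /\ (l == m) = false.
  by rewrite ltnS leq_eqVlt => /orP[/eqP|lm]; [left|right; rewrite ltn_eqF].
have B_C l b : (l < m)%N -> b \in B l -> b \in C.
  by move=> /(sm_B S)[/subsetP B_C _]; apply: B_C.
have A_C i a : a \in A i -> a \in C.
  by have [/subsetP A_C _ _] := sm_A S i; apply: A_C.
have far_up i y : within ell (induced e U) (2 * rho) (h' i) y -> D y < (n%:R - 1) * rho.
  by move=> /(depth_le Dx); have := h'D i; nra.
have far_down i y : within ell (induced e U) (2 * rho) (h' i) y -> (n%:R - 6) * rho <= D y.
  move=> /(within_sym (induced_sym _ e_sym)) /(depth_le Dx); have := h'D i; nra.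
have far_C i y : within ell (induced e U) (2 * rho) (h' i) y -> y \in C -> False.
  by move=> /far_up + /Clow; nra.
split.
- move=> i; have [_ Ac hA] := sm_A S i; have [[TU Tc hT h'T] _ _ _ _] := HT i; split.
  + rewrite subUset TU andbT; apply/subsetP=> a /A_C; exact: (subsetP CU).
  + exact: (connectedU e_sym Ac Tc hA hT).
  + by rewrite inE h'T orbT.
- move=> l /mE[->|[lm ->]]; rewrite ?eqxx.
    split; first by apply/bigcupsP=> i _; have [_ [? _ _ _] _ _ _] := HT i.
    by apply: (connected_bigU (x := x)) => // i; have [_ [_ ? ? _] _ _ _] := HT i.
  have [B_C' Bc] := sm_B S lm; split=> //; exact: subset_trans CU.
- move=> i l /mE[->|[lm ->]]; rewrite ?eqxx.
    have [_ [_ _ _ [a [b [aT bB ab]]]] _ _ _] := HT i.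
    exists a, b; split=> //; first by rewrite inE aT orbT.
    by apply/bigcupP; exists i.
  by have [a [b [aA bB ab]]] := sm_adj S i lm; exists a, b; rewrite inE aA.
- move=> i i' ii'; rewrite -setI_eq0; apply/eqP/setP=> q; rewrite !inE.
  apply/negP=> /andP[/orP[qi|qi] /orP[qi'|qi']].
  + by have := sm_AA S ii'; rewrite disjoint_subset => /subsetP/(_ q qi)/negP.
  + by rewrite eq_sym in ii'; have := TA _ _ _ ii' qi'; rewrite qi.
  + by have := TA _ _ _ ii' qi; rewrite qi'.
  + by have := TT _ _ _ ii' qi; rewrite qi'.
- move=> l l' /andP[ll' l'm]; have lm : (l < m)%N by lia.
  rewrite (ltn_eqF lm); case/mE: l'm => [E|[l'm ->]]; last by apply: (sm_BB S); rewrite ll'.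
  rewrite E eqxx -setI_eq0; apply/eqP/setP=> q; rewrite !inE; apply/negP.
  move=> /andP[/(B_C _ _ lm)/Clow h1 /bigcupP[i _ /Bhigh]]; nra.
- move=> i l /mE[->|[lm ->]]; rewrite ?eqxx -setI_eq0; apply/eqP/setP=> q; rewrite !inE; apply/negP.
    move=> /andP[/orP[/A_C/Clow|/Tlow] + /bigcupP[i' _ /Bhigh]]; nra.
  move=> /andP[/orP[qA|qT] qB].
    by have := sm_AB S i lm; rewrite disjoint_subset => /subsetP/(_ q qA)/negP.
  by apply: (sm_hB S (i := i) lm qB); apply: TC => //; apply: B_C qB.
- move=> i i' ii' /(within_trans (within_sym e_sym (hh' i))) /within_trans /(_ (hh' i')).
  have -> : 6 * rho + (d - 12 * rho) + 6 * rho = d by lra.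
  exact: (sm_far S ii').
- move=> i i' a ii' /setUP[/A_C aC /far_C/(_ aC)//|aT w].
  apply: (far16 i i' ii').
  have -> : 16 * rho = 6 * rho + 2 * rho + 8 * rho by lra.
  apply: within_trans (within_sym e_sym (Th _ _ aT)).
  apply: within_trans (within_sym e_sym (hh' i)) _.
  by apply: within_sub w => y z /and3P[].
- move=> i l b /mE[->|[lm ->]]; rewrite ?eqxx.
    by move=> /bigcupP[i' _ /Bhigh] + /far_down; lra.
  by move=> /(B_C _ _ lm) bC /far_C; apply.
Qed.

Lemma spread_model_lift r j v U m d A B h :
  (1 < r)%N -> U \in clusters j v -> (16 + 12 * j%:R) * rho <= d ->
  @spread_model r U m d A B h ->
  exists d' A' B' h', @spread_model r (component e setT v) (m + j) d' A' B' h'.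
Proof.
move=> r1; elim: j U m d A B h => [|j IHj] U m d A B h /=.
  by move/set1P=> -> _ S; exists d, A, B, h; rewrite addn0.
case/bigcupP=> C Cv UC dj S.
have [vC Cc] := clusters_self Cv; have rho0 := rho_gt0.
have j0 : 0 <= j%:R :> R by apply: ler0n.
have [n E vn] : exists2 n, U = component e (strip C n) v & v \in strip C n.
  by case/set2P: UC => ->; eexists; rewrite // strip_indexP // eqxx ?orbT.
rewrite E -natr1 in dj S.
have [|A1 [B1 [h1 S1]]] := spread_model_step r1 Cc vn _ S; first by nra.
by have := IHj C _ _ _ _ _ Cv _ S1; rewrite addSnnS; apply; nra.
Qed.

Lemma spread_model_init r U d h : 2 * rho <= d -> (forall i, h i \in U) ->
  (forall i i' : 'I_r, i != i' -> ~ within ell e d (h i) (h i')) ->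
  @spread_model r U 0 d (fun i => [set h i]) (fun=> set0) h.
Proof.
move=> d2 hU far; have rho0 := rho_gt0.
have far2 i i' : i != i' -> ~ within ell (induced e U) (2 * rho) (h i) (h i').
  move=> ii' w; apply: (far i i' ii'); apply: within_le d2 _.
  by apply: within_sub w => a b /and3P[].
split=> //.
- move=> i; split; rewrite ?sub1set ?set11 //.
  by move=> a b /set1P-> /set1P->; apply: connect0.
- move=> i i' ii'; rewrite disjoints1 inE; apply/eqP=> E; apply: (far i i' ii').
  by rewrite E; apply: within_refl; lra.
- by move=> l l'; rewrite ltn0 andbF.
- by move=> i i' a ii' /set1P->; apply: far2.
Qed.

Lemma connected_verts G A x y : subrel e (adj G) -> connected_in e A ->
  x \in A -> y \in A -> x != y -> A \subset verts G.
Proof.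
move=> eG Ac xA yA xy; apply/subsetP=> a aA.
have [b bA ab] : exists2 b, b \in A & a != b.
  by have [ax|ax] := eqVneq a x; [exists y; rewrite // ax|exists x].
have /connectP[[|c p] /=] := Ac a b aA bA; first by move=> _ E; rewrite E eqxx in ab.
by move=> /andP[/and3P[_ _ /eG ac] _] _; apply: adj_verts ac.
Qed.

Lemma spread_model_minor (W : finType) (M : sgraph W) (G : sgraph V) r U d A B h :
  subrel e (adj G) -> (#|W| < r)%N -> @spread_model r U r d A B h ->
  ~ excludes_minor G M.
Proof.
move=> eG Wr S; apply.
have rank_lt (w : W) : (enum_rank w < r)%N by apply: ltn_trans Wr.
pose f w := A (Ordinal (rank_lt w)) :|: B (enum_rank w).
have r0 : (0 < r)%N by apply: leq_trans Wr.
apply: (model_minor (h (Ordinal r0)) (B := f)).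
have edge (w w' : W) : exists a b,
    [/\ a \in A (Ordinal (rank_lt w)), b \in B (enum_rank w') & e a b].
  exact: sm_adj S _ _ (rank_lt w').
have neq (w w' : W) : w != w' -> Ordinal (rank_lt w) != Ordinal (rank_lt w').
  by apply: contra_neq => /(congr1 val)/= /ord_inj /enum_rank_inj.
have eadj a b : e a b -> adj G a b by apply: eG.
have disj (X Y : {set V}) (z : V) : [disjoint X & Y] -> z \in X -> z \in Y -> False.
  by move=> dXY zX; rewrite (disjointFr dXY zX).
split.
- move=> w _; have [a [b [aA bB ab]]] := edge w w.
  have [_ Ac _] := sm_A S (Ordinal (rank_lt w)).
  have [_ Bc] := sm_B S (rank_lt w).
  have fc : connected_in e (f w).
    apply: (@connected_star _ _ _ a) => // z /setUP[] zX.
      by apply: connect_inducedS (Ac a z aA zX); apply: subsetUl.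
    apply: (@connect_trans _ _ b).
      by apply: connect1; rewrite /induced /f !inE aA bB ab orbT.
    by apply: connect_inducedS (Bc b z bB zX); apply: subsetUr.
  have af : a \in f w by rewrite inE aA.
  have bf : b \in f w by rewrite inE bB orbT.
  split; first by apply/set0Pn; exists a.
    by apply: (connected_verts eG fc af bf); apply: adj_neq (eG _ _ ab).
  move=> x y xf yf; apply: connect_sub (fc x y xf yf) => c c' /and3P[cf cf' cc'].
  by apply: connect1; rewrite /induced cf cf' (eG _ _ cc').
- move=> w w' _ _ ww'; rewrite -setI_eq0; apply/eqP/setP=> z; rewrite !inE.
  apply/negP=> /andP[/orP[zw|zw] /orP[zw'|zw']].
  + exact: disj (sm_AA S (neq _ _ ww')) zw zw'.
  + exact: disj (sm_AB S _ (rank_lt w')) zw zw'.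
  + exact: disj (sm_AB S _ (rank_lt w)) zw' zw.
  + have : (enum_rank w != enum_rank w' :> nat).
      by apply: contra_neq ww' => /ord_inj /enum_rank_inj.
    rewrite neq_ltn => /orP[] lt.
      by apply: (disj _ _ z (sm_BB S _)) zw zw'; rewrite lt rank_lt.
    by apply: (disj _ _ z (sm_BB S _)) zw' zw; rewrite lt rank_lt.
- move=> w w' _; have [a [b [aA bB ab]]] := edge w w'.
  by exists a, b; rewrite !inE aA bB orbT (eG _ _ ab).
Qed.

Lemma separated_bound (W : finType) (M : sgraph W) (G : sgraph V) v U (N : {set V}) :
  let r := #|W|.+2 in
  subrel e (adj G) -> excludes_minor G M -> U \in clusters r v -> N \subset U ->
  {in N &, forall x y, x != y -> ~ within ell e ((16 + 12 * r%:R) * rho) x y} ->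
  (#|N| < r)%N.
Proof.
move=> r eG GM Uv NU far; rewrite ltnNge; apply/negP=> rN.
have rho0 := rho_gt0; have r0 : 0 <= r%:R :> R by apply: ler0n.
pose h (i : 'I_r) := enum_val (widen_ord rN i).
have hN i : h i \in N by apply: enum_valP.
have S0 : @spread_model r U 0 ((16 + 12 * r%:R) * rho) (fun i => [set h i]) (fun=> set0) h.
  apply: spread_model_init; first by nra.
    by move=> i; apply: (subsetP NU).
  move=> i i' ii'; apply: far => //.
  by apply: contra_neq ii' => /enum_val_inj /(congr1 val)/= /ord_inj.
have [//|d' [A [B [h' S]]]] := spread_model_lift _ Uv (lexx _) S0.
by apply: spread_model_minor eG _ S GM.
Qed.

Lemma clusters_net (S U : {set V}) d : 0 <= d -> exists N : {set V},
  [/\ N \subset S :&: U,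
      {in N &, forall x y, x != y -> ~ within ell e d x y} &
      forall x, x \in S :&: U -> exists2 n, n \in N & within ell e d x n].
Proof.
move=> d0.
pose P (N : {set V}) := (N \subset S :&: U) &&
  `[< {in N &, forall x y, x != y -> ~ within ell e d x y} >].
have P0 : P set0 by rewrite /P sub0set; apply/asboolP=> x y; rewrite inE.
have [N /maxsetP[/andP[NSU /asboolP Nfar] Nmax] _] := maxset_exists P0.
exists N; split=> // x xSU; have [xN|xN] := boolP (x \in N).
  by exists x => //; apply: within_refl.
have [//|H] := pselect (exists2 n, n \in N & within ell e d x n).
suff PxN : P (x |: N).
  by move: xN; rewrite -(Nmax _ PxN (subsetUr _ _)) setU11.
rewrite /P subUset sub1set xSU NSU; apply/asboolP=> a b /setU1P[->|aN] /setU1P[->|bN].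
- by rewrite eqxx.
- by move=> _ w; apply: H; exists b.
- by move=> _ w; apply: H; exists a => //; apply: within_sym.
- exact: Nfar.
Qed.

End Clusters.

Lemma two_hop_cover (R : realType) (V W : finType) (M : sgraph W) (G : sgraph V)
    (ell : {set V} -> R) (rho : R) (S : {set V}) :
  let r := #|W|.+2 in
  positive_lengths G ell -> excludes_minor G M -> 0 < rho ->
  exists P : {set V * V},
    [/\ P \subset setX S S, (#|P| <= #|S| * (2 ^ r * r))%N &
        forall x y, x \in S -> y \in S -> within ell (adj G) rho x y ->
          exists n, [/\ (x, n) \in P, (y, n) \in P,
            within ell (adj G) ((17 + 12 * r%:R) * rho) x n &
            within ell (adj G) ((17 + 12 * r%:R) * rho) y n]].
Proof.
move=> r pos GM rho0; set d := (16 + 12 * r%:R) * rho.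
have d0 : 0 <= d by rewrite mulr_ge0 ?addr_ge0 ?mulr_ge0 ?ler0n ?ltW.
pose e : rel V := fun x y => adj G x y && (ell [set x; y] <= rho).
have e_sym : symmetric e by move=> x y; rewrite /e adj_sym setUC.
have eG : subrel e (adj G) by move=> x y /andP[].
have e_pos : pos_rel ell e by move=> x y /andP[/pos].
have Gpos : pos_rel ell (adj G) by move=> x y; apply: pos.
have e_short x y : e x y -> ell [set x; y] <= rho by case/andP.
have /choice[depth depthP] : forall U : {set V}, exists D : V -> R,
    U != set0 -> connected_in e U -> exists2 x, x \in U & is_depth ell e U x D.
  move=> U; have [[U0 Uc]|H] := pselect (U != set0 /\ connected_in e U).
    have /set0Pn[x xU] := U0; have [D DP] := depth_exists e_pos Uc xU.
    by exists D => _ _; exists x.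
  by exists (fun=> 0) => U0 Uc; case: H.
have /choice[N NP] := fun U => @clusters_net R V ell e e_sym S U d d0.
pose cl := clusters e rho depth r.
have NS U n : n \in N U -> n \in S.
  by have [/subsetP NSU _ _] := NP U => /NSU; rewrite inE => /andP[].
have NU x U : U \in cl x -> (#|N U| <= r)%N.
  move=> Ux; have [NSU Nfar _] := NP U; apply: ltnW.
  apply: (separated_bound e_sym e_pos rho0 e_short depthP eG GM Ux _ Nfar).
  by apply: subset_trans NSU (subsetIr _ _).
exists (\bigcup_(x in S) [set (x, n) | n in \bigcup_(U in cl x) N U]); split.
- apply/bigcupsP=> x xS; apply/subsetP=> _ /imsetP[n /bigcupP[U _ /NS nS] ->].
  by rewrite in_setX xS.
- apply: leq_trans (card_bigcup_le _ _) _; rewrite -sum_nat_const.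
  apply: leq_sum => x _; apply: leq_trans (leq_imset_card _ _) _.
  apply: leq_trans (card_bigcup_le _ _) _.
  apply: (@leq_trans (\sum_(U in cl x) r)); first by apply: leq_sum => U; apply: NU.
  by rewrite sum_nat_const leq_mul2r clusters_card orbT.
- move=> x y xS yS [p [ep lp wp]].
  have ep' : path e x p.
    elim: p x ep wp {lp xS} => //= a p IHp x /andP[xa ep].
    rewrite walk_length_cons => wp; have xa0 := pos _ xa.
    have p0 := walk_length_ge0 Gpos ep.
    by rewrite /e xa IHp // ?andbT; lra.
  have [U Ux xpU] := clusters_walk e_sym e_pos rho0 depthP r ep' wp.
  have yU : y \in U by apply: xpU; rewrite -lp mem_last.
  have xU : x \in U by apply: xpU; rewrite mem_head.
  have Uy : U \in cl y := clusters_mem e_sym e_pos rho0 depthP Ux yU.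
  have [_ _ /(_ x)] := NP U; rewrite inE xS xU => /(_ isT)[n nN xn].
  have {}xn : within ell (adj G) d x n by apply: within_sub xn.
  have dr : (17 + 12 * r%:R) * rho = rho + d by rewrite /d; lra.
  have xy : within ell (adj G) rho x y by exists p.
  exists n; rewrite dr; split.
  + by apply/bigcupP; exists x => //; apply/imset_f/bigcupP; exists U.
  + by apply/bigcupP; exists y => //; apply/imset_f/bigcupP; exists U.
  + by apply: within_le xn; lra.
  + by apply: within_trans xn; apply: within_sym xy; apply: adj_sym.
Qed.

(** * Spanners of the terminal metric *)

Lemma representatives_card (V : finType) (T : {set V}) (f g : V -> V) :
  {in T, forall x, f x \in T} -> {in T, forall x, g x \in T} ->
  {in T, forall x, f (f x) = f x} -> {in T, forall x, g (f x) = g x} ->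
  (#|[set x in T | (f x == x) && [exists y in T, (f y != x) && (g y == g x)]]|
   + 2 * #|[set x in T | g x == x]| <= 2 * #|[set x in T | f x == x]|)%N.
Proof.
move=> fT gT ff gf; set S := [set x in T | _]; set C := [set x in T | g x == x].
set F := [set x in T | f x == x].
have fCF : f @: C \subset F.
  by apply/subsetP=> y /imsetP[c] /[!inE] /andP[cT _] ->; rewrite fT //= ff.
have cardC : #|f @: C| = #|C|.
  apply: card_in_imset => c c' /[!inE] /andP[cT /eqP gc] /andP[cT' /eqP gc'] E.
  by rewrite -gc -gc' -(gf c) // E gf.
pose S1 := F :\: f @: C.
have sub : S \subset S1 :|: (f \o g) @: S1.
  apply/subsetP=> x; rewrite inE => /and3P[xT /eqP fx /exists_inP[y yT /andP[fyx /eqP gyx]]].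
  rewrite inE in_setD [x \in F]inE xT fx eqxx andbT.
  have [/imsetP[c]|//] := boolP (x \in f @: C); rewrite inE => /andP[cT /eqP gc] xE.
  have fgx : f (g x) = x by rewrite {1}xE gf // gc.
  apply/orP; right; apply/imsetP; exists (f y); last by rewrite /= gf // gyx.
  rewrite in_setD inE fT //= ff // eqxx andbT; apply: contra fyx => /imsetP[c'].
  rewrite inE => /andP[cT' /eqP gc'] E; rewrite E -gc' -(gf c') // -E gf // gyx.
  by rewrite fgx.
have cardS1 : (#|S1| + #|C| = #|F|)%N.
  by rewrite addnC -cardC -(setIidPr fCF) cardsID.
have := leq_trans (subset_leq_card sub) (leq_card_setU _ _).
by have := leq_imset_card (f \o g) S1; lia.
Qed.

Lemma sum_shift_bound (s a : nat -> nat) (m l k : nat) :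
  (forall i, s i + 2 * a (i + l) <= 2 * a i)%N -> (forall i, a i <= k)%N ->
  (\sum_(i < m) s i <= 2 * (l * k))%N.
Proof.
move=> sa ak.
have h1 : (\sum_(i < m) s i + 2 * \sum_(i < m) a (i + l) <= 2 * \sum_(i < m) a i)%N.
  by rewrite !big_distrr -big_split /=; apply: leq_sum.
have h2 : (\sum_(i < m) a i <= \sum_(i < l) a i + \sum_(i < m) a (i + l))%N.
  have -> : (\sum_(i < l) a i + \sum_(i < m) a (i + l) = \sum_(i < m + l) a i)%N.
    rewrite addnC [in RHS]addnC big_split_ord /= addnC; congr (_ + _)%N.
    by apply: eq_bigr => i _; rewrite addnC.
  by rewrite big_split_ord /= leq_addr.
have h3 : (\sum_(i < l) a i <= l * k)%N.
  by rewrite -[l in (l * k)%N]card_ord -sum_nat_const; apply: leq_sum.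
lia.
Qed.

Section DistanceBounds.
Variables (R : realType) (V : finType) (ell : {set V} -> R) (e : rel V).
Hypothesis e_pos : pos_rel ell e.

Lemma within_ge0 L x y : within ell e L x y -> 0 <= L.
Proof. by case=> p [ep _]; apply: le_trans; apply: walk_length_ge0 ep. Qed.

Lemma min_distance : exists2 delta, 0 < delta &
  forall x y L, x != y -> within ell e L x y -> delta <= L.
Proof.
have [delta d0 dmin] : exists2 delta, 0 < delta &
    forall x y, e x y -> delta <= ell [set x; y].
  pose P (p : V * V) := e p.1 p.2.
  have [p0 Pp0|H] := pickP P; last first.
    by exists 1 => // x y exy; have := H (x, y); rewrite /P /= exy.
  case: (@arg_minP _ _ _ p0 P (fun p => ell [set p.1; p.2]) Pp0) => -[a b] ab min.
  exists (ell [set a; b]); first exact: e_pos.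
  by move=> x y exy; apply: (min (x, y)).
exists delta => // x y L xy [[|z p] [/= ep lp wp]]; first by rewrite lp eqxx in xy.
case/andP: ep => xz ep; have := walk_length_ge0 e_pos ep; have := dmin _ _ xz.
by rewrite walk_length_cons in wp; lra.
Qed.

Lemma max_distance : exists B, forall x y L,
  within ell e L x y -> within ell e B x y.
Proof.
have /choice[b Hb] : forall p : V * V, exists b, forall L,
    within ell e L p.1 p.2 -> 0 <= b /\ within ell e b p.1 p.2.
  move=> p; have [[L w]|H] := pselect (exists L, within ell e L p.1 p.2).
    by exists L => _ _; split=> //; apply: within_ge0 w.
  by exists 0 => L w; case: H; exists L.
exists (\sum_p `|b p|) => x y L w; have [b0 wb] := Hb (x, y) L w.
apply: within_le wb; rewrite (bigD1 (x, y)) //=.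
by apply: le_trans (ler_norm _) _; rewrite lerDl sumr_ge0.
Qed.

End DistanceBounds.

Section Scales.
Variables (R : realType) (V : finType) (ell : {set V} -> R) (e : rel V).
Hypothesis e_sym : symmetric e.
Variables (T : {set V}) (delta : R) (lag : nat).
Hypotheses (delta_gt0 : 0 < delta) (lag3 : (3 < lag)%N) (lagT : (8 * #|T| <= 2 ^ lag)%N).

Definition scale i := delta * 2 ^+ i.

Definition link n : rel V := fun x y =>
  [&& (lag <= n)%N, x \in T, y \in T & `[< within ell e (scale (n - lag)) x y >]].

Definition rep n := fingraph.root (link n).

Definition active i := [set x in T | (rep i x == x) &&
  [exists y in T, (rep i y != x) && (rep (i + lag) y == rep (i + lag) x)]].

Lemma scale_le i j : (i <= j)%N -> scale i <= scale j.
Proof. by move=> ij; rewrite ler_pM2l // ler_weXn2l // ler1n. Qed.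

Lemma link_sym n : fingraph.connect_sym (link n).
Proof.
apply: sym_connect_sym => x y; rewrite /link.
congr (_ && _); rewrite andbCA; do 2!congr (_ && _).
by apply: asbool_equiv_eq; split=> w; apply: within_sym.
Qed.

Lemma link_connect_le n m x y : (n <= m)%N -> connect (link n) x y -> connect (link m) x y.
Proof.
move=> nm; apply: connect_sub => a b /and4P[ln aT bT /asboolP w].
apply: connect1; rewrite /link aT bT (leq_trans ln nm) /=; apply/asboolP.
by apply: within_le w; apply: scale_le; lia.
Qed.

Lemma link_connect_T n x y : x \in T -> connect (link n) x y -> y \in T.
Proof.
move=> xT /connectP[p ep ->]; elim: p x xT ep => //= a p IHp x xT /andP[/and4P[_ _ aT _]].
exact: IHp.
Qed.

Lemma rep_T n x : x \in T -> rep n x \in T.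
Proof. by move=> xT; apply: (link_connect_T xT); apply: connect_root. Qed.

Lemma rep_rep n x : rep n (rep n x) = rep n x.
Proof. exact: root_root (link_sym n) x. Qed.

Lemma rep_le n m x : (n <= m)%N -> rep m (rep n x) = rep m x.
Proof.
move=> nm; apply/esym/eqP; rewrite (root_connect (link_sym m)).
by apply: link_connect_le nm _; apply: connect_root.
Qed.

Lemma rep_within n x : x \in T ->
  rep n x = x \/ (3 <= n)%N /\ within ell e (scale (n - 3)) x (rep n x).
Proof.
move=> xT; have /connectP[p0 ep0] := connect_root (link n) x.
case/shortenP: ep0 => p ep up _; rewrite -/(rep n x) => lp.
case: p ep up lp => [|a p] ep up lp; [by left|right].
have ln : (lag <= n)%N by case/andP: ep => /and4P[].
split; first by lia.
have pT : {subset x :: a :: p <= T}.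
  move=> z zp; have [p1 [p2 [E lz]]] : exists p1 p2, a :: p = p1 ++ p2 /\ last x p1 = z.
    by case/splitPl: zp => p1 p2 lz; exists p1, p2.
  move: ep; rewrite E cat_path => /andP[ep _]; apply: (@link_connect_T n x z) => //.
  by apply/connectP; exists p1.
have szp : (size (a :: p) <= #|T|)%N.
  have := card_uniqP up => /= sz; apply: ltnW; rewrite -sz.
  by apply: subset_leq_card; apply/subsetP.
have step (q : seq V) y : path (link n) y q ->
    within ell e ((size q)%:R * scale (n - lag)) y (last y q).
  elim: q y => [|b q IHq] y /=; first by rewrite mul0r => _; apply: within_refl.
  case/andP=> /and4P[_ _ _ /asboolP yb] /IHq; rewrite -[_.+1]add1n natrD mulrDl mul1r.
  exact: within_trans.
rewrite lp; apply: within_le (step _ _ ep).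
have sc0 i : 0 <= scale i by rewrite mulr_ge0 ?exprn_ge0 // ltW.
apply: (@le_trans _ _ (#|T|%:R * scale (n - lag))).
  by rewrite ler_wpM2r // ler_nat.
have En : scale (n - 3) * 8 = scale (n - lag) * 2 ^+ lag.
  have n3 : (3 <= n)%N by lia.
  by rewrite /scale -!mulrA (_ : 8 = 2 ^+ 3) -?natrX // -!natrM -!expnD !subnK.
have : (8 * #|T|)%:R <= 2 ^+ lag :> R by rewrite -natrX ler_nat.
rewrite natrM => /(ler_wpM2l (sc0 (n - lag)%N)); lra.
Qed.

Lemma active_card m : (\sum_(i < m) #|active i| <= 2 * (lag * #|T|))%N.
Proof.
pose a i := #|[set x in T | rep i x == x]|.
apply: (@sum_shift_bound (fun i => #|active i|) a) => i.
  apply: representatives_card => x xT; try exact: rep_T.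
    by rewrite rep_rep.
  by rewrite rep_le // leq_addr.
by apply: subset_leq_card; apply/subsetP=> x; rewrite inE => /andP[].
Qed.

Lemma rep_active i x y : x \in T -> y \in T -> within ell e (scale i) x y ->
  rep i x != rep i y -> rep i x \in active i.
Proof.
move=> xT yT xy ne; rewrite inE rep_T // rep_rep eqxx /=.
apply/exists_inP; exists y => //; rewrite eq_sym ne /= rep_le ?leq_addr //.
rewrite (root_connect (link_sym _)) (link_sym _); apply: connect1.
by rewrite /link xT yT leq_addl addnK; apply/asboolP.
Qed.

Section Coarsening.
Variables (c : R) (Q : R -> V -> V -> Prop).
Hypotheses (c_ge0 : 0 <= c) (Q_le : forall L1 L2 x y, L1 <= L2 -> Q L1 x y -> Q L2 x y)
  (Q_refl : forall L x, 0 <= L -> Q L x x)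
  (Q_sym : forall L x y, Q L x y -> Q L y x)
  (Q_trans : forall L1 L2 y x z, Q L1 x y -> Q L2 y z -> Q (L1 + L2) x z).

(* The detours from [x] and [y] to their representatives are eight times shorter
   than the current scale, so a stretch [alpha] carries over to this scale as soon
   as [4 c + 2 alpha / 8 <= alpha]. *)
Lemma scale_induction m :
  (forall i x y, (i < m)%N -> x \in active i -> y \in active i ->
     within ell e (scale i.+1) x y -> Q (2 * (c * scale i.+1)) x y) ->
  forall i x y, (i < m)%N -> x \in T -> y \in T -> within ell e (scale i) x y ->
    Q (6 * c * scale i) x y.
Proof.
move=> HQ; elim/ltn_ind=> i IHi x y im xT yT xy.
have sc0 j : 0 <= scale j by rewrite mulr_ge0 ?exprn_ge0 // ltW.
have near z : z \in T ->
    within ell e (scale i / 8) z (rep i z) /\ Q (6 * c * (scale i / 8)) z (rep i z).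
  move=> zT; have := sc0 i => sci; case: (rep_within i zT) => [->|[i3 w]].
    split; first by apply: within_refl; nra.
    by apply: Q_refl; have := mulr_ge0 c_ge0 sci; lra.
  have E : scale i / 8 = scale (i - 3).
    have h8 : 8 = 2 ^+ 3 :> R by rewrite -natrX.
    by rewrite /scale h8 -{1}(subnK i3) exprD mulrA mulfK // expf_neq0.
  by rewrite E; split=> //; apply: IHi => //; [lia|lia|exact: rep_T].
have [xu Qxu] := near x xT; have [yv Qyv] := near y yT.
have mc : 0 <= c * scale i by rewrite mulr_ge0.
have [E|ne] := eqVneq (rep i x) (rep i y).
  rewrite E in Qxu; apply: Q_le (Q_trans Qxu (Q_sym Qyv)); nra.
have uv : within ell e (scale i.+1) (rep i x) (rep i y).
  have := within_trans (within_trans (within_sym e_sym xu) xy) yv.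
  by apply: within_le; rewrite /scale exprS -/(scale _); have := sc0 i; rewrite /scale; lra.
have ua : rep i x \in active i by apply: rep_active xT yT xy ne.
have va : rep i y \in active i.
  by apply: rep_active yT xT (within_sym e_sym xy) _; rewrite eq_sym.
apply: Q_le (Q_trans (Q_trans Qxu (HQ _ _ _ im ua va uv)) (Q_sym Qyv)).
have -> : scale i.+1 = 2 * scale i by rewrite /scale exprS mulrCA.
nra.
Qed.

End Coarsening.
End Scales.

Lemma spanner_exists (R : realType) (V W : finType) (M : sgraph W) (G : sgraph V)
    (ell : {set V} -> R) (T : {set V}) :
  let r := #|W|.+2 in
  let c := 17 + 12 * r%:R in
  positive_lengths G ell -> excludes_minor G M ->
  exists P : {set V * V},
    [/\ P \subset setX T T,
        (#|P| <= 2 ^ r * r * (2 * ((4 + trunc_log 2 #|T|) * #|T|)))%N &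
        forall Q : R -> V -> V -> Prop,
          (forall L1 L2 x y, L1 <= L2 -> Q L1 x y -> Q L2 x y) ->
          (forall L x, 0 <= L -> Q L x x) ->
          (forall L x y, Q L x y -> Q L y x) ->
          (forall L1 L2 y x z, Q L1 x y -> Q L2 y z -> Q (L1 + L2) x z) ->
          (forall x y L, (x, y) \in P -> within ell (adj G) L x y -> Q L x y) ->
          forall x y L, x \in T -> y \in T -> within ell (adj G) L x y ->
            Q (12 * c * L) x y].
Proof.
move=> r c pos GM.
have e_pos : pos_rel ell (adj G) by move=> x y; apply: pos.
have e_sym := @adj_sym _ G.
have [delta d0 dmin] := min_distance e_pos.
have [B HB] := max_distance e_pos.
set lag := (4 + trunc_log 2 #|T|)%N.
have lag3 : (3 < lag)%N by [].
have lagT : (8 * #|T| <= 2 ^ lag)%N.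
  have -> : (lag = 3 + (trunc_log 2 #|T|).+1)%N by rewrite /lag; lia.
  rewrite expnD leq_mul // ltnW //.
  exact: trunc_log_ltn.
have c0 : 0 <= c by rewrite /c; have := ler0n R r; lra.
pose sc := scale delta; pose act := active ell (adj G) T delta lag.
have sc0 i : 0 < sc i by rewrite /sc /scale mulr_gt0 // exprn_gt0.
have /choice[P HPi] := fun i => two_hop_cover (act i) pos GM (sc0 i.+1).
have actT i : act i \subset T by apply/subsetP=> x; rewrite inE => /andP[].
have [N BN] : exists N, B <= sc N.
  exists (Num.truncn (B / delta)).+1; rewrite /sc /scale mulrC -ler_pdivrMr //.
  apply/ltW/(lt_le_trans (truncnS_gt _)); rewrite -natrX ler_nat.
  exact/ltnW/ltn_expl.
exists (\bigcup_(i < N.+1) P i); split.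
- apply/bigcupsP=> i _; have [PS _ _] := HPi i; apply: subset_trans PS _.
  by apply: setXS.
- apply: leq_trans (card_bigcup_le _ _) _.
  apply: (@leq_trans (\sum_(i < N.+1) #|act i| * (2 ^ r * r))%N).
    by apply: leq_sum => i _; have [] := HPi i.
  rewrite -big_distrl /= mulnC leq_mul2l.
  by rewrite (active_card ell e_sym d0) // orbT.
move=> Q Qle Qrefl Qsym Qtrans QP.
have small i x y : (i < N.+1)%N -> x \in T -> y \in T ->
    within ell (adj G) (sc i) x y -> Q (6 * c * sc i) x y.
  apply: (scale_induction e_sym d0 lag3 lagT c0 Qle Qrefl Qsym Qtrans).
  move=> {}i {}x {}y iN xa ya xy.
  have [_ _ /(_ x y xa ya xy)[n [xn yn wxn wyn]]] := HPi i.
  have sub p : p \in P i -> p \in \bigcup_(j < N.+1) P j.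
    by move=> pP; apply/bigcupP; exists (Ordinal iN).
  rewrite mulr_natl mulr2n; apply: Qtrans (QP _ _ _ (sub _ xn) wxn) _.
  exact/Qsym/(QP _ _ _ (sub _ yn) wyn).
move=> x y L xT yT xy.
have L0 : 0 <= L by apply: within_ge0 xy.
have [<-|ne] := eqVneq x y; first by apply: Qrefl; rewrite !mulr_ge0.
have dL := dmin _ _ _ ne xy.
have [i iN [wi iL]] : exists2 i, (i < N.+1)%N &
    within ell (adj G) (sc i) x y /\ sc i <= 2 * L.
  have wN : within ell (adj G) (sc N) x y by apply: within_le BN (HB _ _ _ xy).
  have [LN|NL] := leP L (sc N); last by exists N => //; split=> //; lra.
  have ex : exists i, L <= sc i by exists N.
  case: (ex_minnP ex) => i Li min; exists i; first by rewrite ltnS min.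
  split; first exact: within_le xy.
  case: i Li min => [|i] _ min; first by rewrite /sc /scale expr0; lra.
  have : ~~ (L <= sc i) by apply/negP=> /min; rewrite ltnn.
  by rewrite -ltNge /sc /scale exprS mulrCA => Li; rewrite ler_pM2l // ltW.
apply: Qle (small i x y iN xT yT wi).
by have := ler_wpM2l c0 iL; lra.
Qed.

(** * Minimal distance-preserving minors *)

Definition walk_edges (V : finType) (x : V) (p : seq V) : seq {set V} :=
  pairmap (fun a b => [set a; b]) x p.

Section WalkEdges.
Variables (V : finType).
Implicit Types (x y z a b : V) (p q : seq V) (e : {set V}) (G : sgraph V).

Lemma walk_edges_cat x p q :
  walk_edges x (p ++ q) = walk_edges x p ++ walk_edges (last x p) q.
Proof. exact: pairmap_cat. Qed.

Lemma walk_edges_rev x p :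
  walk_edges (last x p) (rev (belast x p)) = rev (walk_edges x p).
Proof.
elim: p x => [|y p IHp] x //=; rewrite !rev_cons -!cats1 walk_edges_cat IHp.
congr (_ ++ _); rewrite /= setUC; congr [:: [set _; _]].
by case: p {IHp} => //= z p; rewrite rev_cons last_rcons.
Qed.

Lemma walk_edges_mem e x p a : e \in walk_edges x p -> a \in e -> a \in x :: p.
Proof.
elim: p x => [|y p IHp] x //=; rewrite inE => /orP[/eqP->|/IHp{}IHp /IHp].
  by rewrite !inE => /orP[]->; rewrite ?orbT.
by rewrite [in X in _ -> X]inE => ->; rewrite orbT.
Qed.

Lemma walk_edges_split e x p : e \in walk_edges x p ->
  exists p1 b p2, p = p1 ++ b :: p2 /\ e = [set last x p1; b].
Proof.
elim: p x => [|y p IHp] x //=; rewrite inE => /orP[/eqP->|/IHp[p1 [b [p2 [-> ->]]]]].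
  by exists [::], y, p.
by exists (y :: p1), b, p2.
Qed.

Lemma path_delete_edge G H e x p : edges H = edges G :\ e ->
  path (adj G) x p -> e \notin walk_edges x p -> path (adj H) x p.
Proof.
move=> E; elim: p x => //= y p IHp x /andP[xy ep]; rewrite inE negb_or => /andP[exy eyp].
by rewrite IHp // andbT /adj E in_setD1 eq_sym exy.
Qed.

Lemma mem_split x p y : y \in x :: p -> exists p1 p2, p = p1 ++ p2 /\ last x p1 = y.
Proof. by case/splitPl=> p1 p2 lx; exists p1, p2. Qed.

End WalkEdges.

Section Within.
Variables (R : realType) (V : finType).

Lemma within_map (ell ell' : {set V} -> R) (e e' : rel V) L x y :
  (forall a b, e a b -> within ell' e' (ell [set a; b]) a b) ->
  within ell e L x y -> within ell' e' L x y.
Proof.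
move=> H [p [ep <- wp]]; apply: within_le wp _.
elim: p x ep => [|z p IHp] x /=; first by rewrite walk_length_nil => _; apply: within_refl.
by case/andP=> /H xz /IHp; rewrite walk_length_cons; apply: within_trans.
Qed.

Definition shortest (ell : {set V} -> R) (e : rel V) x p :=
  path e x p /\ forall q, path e x q -> last x q = last x p ->
    walk_length ell x p <= walk_length ell x q.

Lemma shortest_segment (ell : {set V} -> R) (e : rel V) x p v w : symmetric e ->
  shortest ell e x p -> v \in x :: p -> w \in x :: p ->
  exists s, [/\ path e v s, last v s = w, {subset walk_edges v s <= walk_edges x p} &
    forall q, path e v q -> last v q = w -> walk_length ell v s <= walk_length ell v q].
Proof.
move=> es [ep pmin] vp wp.
have key p1 p2 p3 : p = p1 ++ p2 ++ p3 ->
    [/\ path e (last x p1) p2,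
        {subset walk_edges (last x p1) p2 <= walk_edges x p} &
        forall q, path e (last x p1) q -> last (last x p1) q = last (last x p1) p2 ->
          walk_length ell (last x p1) p2 <= walk_length ell (last x p1) q].
  move=> E; move: ep pmin; rewrite E !cat_path => /and3P[e1 e2 e3] pmin; split=> //.
    by move=> f f2; rewrite !walk_edges_cat !mem_cat f2 orbT.
  move=> q eq lq; have := pmin (p1 ++ q ++ p3).
  rewrite !cat_path e1 eq !last_cat lq e3 => /(_ isT erefl).
  by rewrite !walk_length_cat !lq lerD2l lerD2r.
have [p1 [p2 [E lv]]] := mem_split vp.
move: wp; rewrite E -cat_cons mem_cat => /orP[wp|wp].
  have [q1 [q2 [E1 lw]]] := mem_split wp.
  have [|e2 sub min] := key q1 q2 p2; first by rewrite E E1 catA.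
  have lv' : last w q2 = v by rewrite -lv E1 last_cat lw.
  rewrite lw in e2 sub min.
  have rev_path_sym y q : path e y q -> path e (last y q) (rev (belast y q)).
    by move=> eq; rewrite rev_path; apply: sub_path eq => a b; rewrite es.
  have rev_last y q : last (last y q) (rev (belast y q)) = y.
    by case: q => //= a q; rewrite rev_cons last_rcons.
  exists (rev (belast w q2)); split.
  - by rewrite -lv' rev_path_sym.
  - by rewrite -lv' rev_last.
  - by move=> f; rewrite -lv' walk_edges_rev mem_rev -E; apply: sub.
  - move=> q eq lq; rewrite -{1}lv' walk_length_rev -(walk_length_rev _ v q) lq.
    by apply: min; rewrite -lq ?rev_path_sym // rev_last lq lv'.
have {}wp : w \in v :: p2 by rewrite inE wp orbT.
have [q1 [q2 [E1 lw]]] := mem_split wp.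
have [|e2 sub min] := key p1 q1 q2; first by rewrite E E1.
rewrite lv lw in e2 sub min.
by exists q1; split; rewrite -?E.
Qed.

End Within.

Section Preserving.
Variables (R : realType) (V : finType) (G : sgraph V) (ell : {set V} -> R).
Variables (T : {set V}) (P : {set V * V}).
Hypotheses (G_pos : pos_rel ell (adj G)) (PT : P \subset setX T T).

Definition preserving (H : sgraph V) (len : {set V} -> R) :=
  [/\ minor T G H, pos_rel len (adj H),
      forall x y L, x \in T -> y \in T ->
        within len (adj H) L x y -> within ell (adj G) L x y &
      forall x y L, (x, y) \in P ->
        within ell (adj G) L x y -> within len (adj H) L x y].

Definition size_of (H : sgraph V) := (#|verts H| + #|edges H|)%N.

Lemma minimal_preserving : exists H len, preserving H len /\
  forall K lenK, preserving K lenK -> (size_of H <= size_of K)%N.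
Proof.
pose Pn n := `[< exists H len, preserving H len /\ size_of H = n >].
have ex : exists n, Pn n.
  exists (size_of G); apply/asboolP; exists G, ell; split=> //.
  by split=> //; apply: rt_refl.
case: (ex_minnP ex) => n /asboolP[H [len [HP <-]]] min.
by exists H, len; split=> // K lenK KP; apply: min; apply/asboolP; exists K, lenK.
Qed.

Section Minimal.
Variables (H : sgraph V) (len : {set V} -> R).
Hypotheses (HP : preserving H len)
  (Hmin : forall K lenK, preserving K lenK -> (size_of H <= size_of K)%N).

Lemma no_smaller K lenK : minor_step T H K -> ~ preserving K lenK.
Proof. by move=> /minor_step_lt lt /Hmin; rewrite leqNgt lt. Qed.

Lemma minor_step_trans K : minor_step T H K -> minor T G K.
Proof. by have [GH _ _ _] := HP => HK; apply: rt_trans GH (rt_step _ _ _ _ HK). Qed.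

Definition is_route (q : V * V) p :=
  [/\ shortest len (adj H) q.1 p, last q.1 p = q.2 & uniq (q.1 :: p)].

Definition essential (e : {set V}) (q : V * V) p :=
  forall p', path (adj H) q.1 p' -> last q.1 p' = q.2 ->
    walk_length len q.1 p' <= walk_length len q.1 p -> e \in walk_edges q.1 p'.

Lemma essential_exists e : e \in edges H -> exists q,
  [/\ q \in P, exists p, is_route q p & forall p, is_route q p -> essential e q p].
Proof.
move=> eH; apply: contrapT => none.
have [K [HK VK EK]] := delete_edge T eH.
have [_ Hpos HG GH] := HP.
have KH : subrel (adj K) (adj H) by move=> a b; rewrite /adj EK => /setD1P[].
apply: (no_smaller HK (lenK := len)); split.
- exact: minor_step_trans.
- by move=> a b /KH /Hpos.
- by move=> x y L xT yT w; apply: HG => //; apply: within_sub w.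
move=> x y L xyP /(GH _ _ _ xyP)[p0 [ep0 lp0 wp0]].
have [|p [ep lp up pmin]] := shortest_exists (y := y) Hpos (x := x).
  by apply/connectP; exists p0.
apply: contrapT => nw; apply: none; exists (x, y); split=> //.
  by exists p; split=> //; split=> // q eq lq; apply: pmin; rewrite // lq lp.
move=> p' [[ep' pmin'] lp' _] p1 ep1 lp1 wp1; apply: contrapT => /negP ne.
apply: nw; exists p1; split=> //; first exact: path_delete_edge EK ep1 ne.
by apply: le_trans wp1 (le_trans (pmin' p0 ep0 _) wp0); rewrite lp0.
Qed.

Lemma route_exists : exists route : V * V -> seq V,
  forall e, e \in edges H -> exists q,
    [/\ q \in P, is_route q (route q) & essential e q (route q)].
Proof.
have /choice[route routeP] : forall q, exists p, (exists p', is_route q p') -> is_route q p.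
  by move=> q; have [[p pq]|H0] := pselect (exists p', is_route q p'); [exists p|exists [::]].
exists route => e /essential_exists[q [qP ex ess]]; exists q.
by split=> //; [apply: routeP|apply: ess; apply: routeP].
Qed.

Lemma route_inner q p v : q \in P -> is_route q p -> v \notin T -> v \in q.1 :: p ->
  exists u w, [/\ u != w, adj H u v, adj H v w &
    forall e, e \in walk_edges q.1 p -> v \in e -> e = [set u; v] \/ e = [set v; w]].
Proof.
move=> qP [[ep _] lp up] vT; have /(subsetP PT) := qP; rewrite inE => /andP[].
move: (q.1) (q.2) ep lp up => x y ep lp up xT yT vp.
move: vp; rewrite inE => /orP[/eqP vx|vp]; first by rewrite vx xT in vT.
have [p1 [p2 E]] : exists p1 p2, p = p1 ++ v :: p2.
  by case/splitPr: vp => p1 p2; exists p1, p2.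
case: p2 E => [|w p2] E.
  by move: lp; rewrite E last_cat /= => vy; rewrite vy yT in vT.
move: ep up; rewrite E cat_path -cat_cons cat_uniq => /and4P[_ uv vw _] /and3P[_ /hasPn dis up].
have {}dis a : a \in [:: v, w & p2] -> a \notin x :: p1 by apply: dis.
exists (last x p1), w; split=> //.
  by apply: contraNneq (dis w _) => [<-|]; rewrite ?mem_last // !inE eqxx orbT.
move=> e; rewrite walk_edges_cat mem_cat /= !inE => /or4P[|/eqP|/eqP|]; [|by left|by right|].
- move=> /walk_edges_mem /[apply] vp1.
  by have := dis v; rewrite mem_head vp1 => /(_ isT).
- by move=> /walk_edges_mem /[apply] vp2; move: up; rewrite /= vp2.
Qed.

Lemma degree_ge3 v : v \in verts H -> v \notin T -> (2 < #|[set u | adj H v u]|)%N.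
Proof.
move=> vH vT; set N := [set u | _]; rewrite ltnNge; apply/negP=> N2.
have [_ Hpos HG GH] := HP.
have [N0|/set0Pn[u0]] := eqVneq N set0.
  have [K [HK VK EK]] := delete_vertex vH vT.
  have vN a : adj H v a = false.
    by have /setP/(_ a) := N0; rewrite !inE.
  have KH a b : adj K a b = adj H a b.
    rewrite (adj_delete_vertex _ _ EK); case ab: (adj H a b) => //=.
    by apply/andP; split; apply: contraTneq ab => ->; rewrite ?(adj_sym _ a v) vN.
  have KK : subrel (adj K) (adj H) by move=> a b; rewrite KH.
  have HK' : subrel (adj H) (adj K) by move=> a b; rewrite KH.
  apply: (no_smaller HK (lenK := len)); split.
  - exact: minor_step_trans.
  - by move=> a b /KK /Hpos.
  - by move=> x y L xT yT w; apply: HG => //; apply: within_sub w.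
  - by move=> x y L xyP /(GH _ _ _ xyP); apply: within_sub.
rewrite inE => vu0; have [route routeP] := route_exists.
have [q [qP qr ess]] := routeP _ vu0.
have vr : v \in q.1 :: route q.
  apply: walk_edges_mem (ess _ _ _ (lexx _)) _; rewrite ?set21 //.
    by have [[]] := qr.
  by have [] := qr.
have [u [w [uw uv vw _]]] := route_inner qP qr vT vr.
have NE : N = [set u; w].
  apply/esym/eqP; rewrite eqEcard cards2 uw N2 andbT.
  by apply/subsetP=> a /set2P[]->; rewrite inE // adj_sym.
have vN a : adj H v a -> a = u \/ a = w.
  by move=> va; have /set2P : a \in [set u; w] by rewrite -NE inE.
have [K [HK VK KE]] := contract_edge uv vT; set m := merge_vertices u v in KE.
have mv : m v = u by rewrite /m /merge_vertices eqxx.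
have mid a : a != v -> m a = a by rewrite /m /merge_vertices => /negPf->.
have nuv : u != v by apply: adj_neq uv.
have nwv : w != v by rewrite eq_sym; apply: adj_neq vw.
have K_edge x y : adj K x y -> adj H x y \/ [set x; y] = [set u; w].
  case/KE=> a [b [ab <- <- mab]]; have [av|av] := eqVneq a v; [subst a|].
    by case: (vN b ab) => bE; subst b; rewrite mv !mid ?eqxx // in mab *; right.
  rewrite (mid a av) in mab *; have [bv|bv] := eqVneq b v; [subst b|].
    rewrite adj_sym in ab; case: (vN a ab) => aE; subst a; rewrite mv ?eqxx // in mab *.
    by right; rewrite setUC.
  by rewrite (mid b bv); left.
have H_edge x y : adj H x y -> x != v -> y != v -> adj K x y.
  by move=> xy xv yv; apply/KE; exists x, y; rewrite !mid //; split=> //; apply: adj_neq xy.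
have uwK : adj K u w by apply/KE; exists v, w; rewrite mv (mid w nwv).
pose s := len [set u; v] + len [set v; w].
pose lenK e := if e == [set u; w] then
  (if adj H u w then Num.min (len [set u; w]) s else s) else len e.
have s0 : 0 < s by rewrite addr_gt0 // Hpos.
have K_within x y : adj K x y -> 0 < lenK [set x; y] /\
    within len (adj H) (lenK [set x; y]) x y.
  have uwP : 0 < lenK [set u; w] /\ within len (adj H) (lenK [set u; w]) u w.
    have ws : within len (adj H) s u w.
      by apply: (within_trans (y := v)); apply: within_edge.
    rewrite /lenK eqxx; have [uwH|//] := boolP (adj H u w).
    by rewrite /Order.min; case: ifP => _; split=> //; [apply: Hpos|apply: within_edge].
  move=> xy; have [E|ne] := eqVneq [set x; y] [set u; w].
    rewrite E; have [? ?] := uwP; split=> //.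
    by have [[-> ->]|[-> ->]] := set2_inj E; last apply: within_sym (@adj_sym _ H) _.
  have [xyH|E] := K_edge _ _ xy; last by rewrite E eqxx in ne.
  by rewrite /lenK (negPf ne); split; [apply: Hpos|apply: within_edge].
have lenK_le x y : adj H x y -> lenK [set x; y] <= len [set x; y].
  move=> xy; rewrite /lenK; case: eqP => // E.
  have -> : adj H u w by rewrite /adj -E.
  by rewrite E ge_min lexx.
have uws : lenK [set u; w] <= s.
  by rewrite /lenK eqxx; case: ifP => // _; rewrite ge_min lexx orbT.
apply: (no_smaller HK (lenK := lenK)); split.
- exact: minor_step_trans.
- by move=> x y /K_within[].
- move=> x y L xT yT xy; apply: HG => //; apply: within_map xy.
  by move=> a b /K_within[].
move=> x y L xyP /(GH _ _ _ xyP)[p [ep lp wp]]; apply: within_le wp _.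
have /(subsetP PT) := xyP; rewrite inE => /andP[/= xT yT].
have xv : x != v by apply: contraNneq vT => <-.
have yv : y != v by apply: contraNneq vT => <-.
have [n] := ubnP (size p); elim: n x p xv ep lp {xyP xT} => // n IHn x [|a p] xv /=.
  by move=> _ -> _; rewrite walk_length_nil; apply: within_refl.
case/andP=> xa ep lp /ltnSE pn; rewrite walk_length_cons.
have [av|av] := eqVneq a v; last first.
  apply: within_trans (IHn a p av ep lp pn).
  by apply: within_le (lenK_le _ _ xa) _; apply: within_edge; apply: H_edge.
subst a; case: p ep lp pn => [|b p] /= ; first by move=> _ E; rewrite E eqxx in yv.
case/andP=> vb ep lp pn; rewrite walk_length_cons addrA.
have bv : b != v by rewrite eq_sym; apply: adj_neq vb.
apply: within_trans (IHn b p bv ep lp (ltnW pn)).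
have vx : adj H v x by rewrite adj_sym.
have [<-|xb] := eqVneq x b; first by apply: within_refl; rewrite addr_ge0 // ltW // Hpos.
have e1 := within_edge lenK uwK.
case: (vN x vx) (vN b vb) => xE [] bE; subst x b; rewrite ?eqxx // in xb.
- exact: within_le e1.
- rewrite addrC [[set w; v]]setUC [[set v; u]]setUC.
  by apply: within_le uws _; apply: within_sym (@adj_sym _ K) _.
Qed.


Lemma vertices_bound : (#|verts H :\: T| <= 2 * #|P| ^ 2)%N.
Proof.
have [route routeP] := route_exists.
pose common (p q : V * V) := [seq z <- q.1 :: route q | z \in p.1 :: route p].
pose F (p q : V * V) := [set head q.1 (common p q); last q.1 (common p q)].
suff sub : verts H :\: T \subset \bigcup_(p in P) \bigcup_(q in P) F p q.
  apply: leq_trans (subset_leq_card sub) _.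
  apply: leq_trans (card_bigcup_le _ _) _.
  rewrite mulnC -mulnA -sum_nat_const; apply: leq_sum => p _.
  apply: leq_trans (card_bigcup_le _ _) _.
  rewrite -sum_nat_const; apply: leq_sum => q _.
  by rewrite cards2; case: (_ != _).
apply/subsetP=> v; rewrite inE => /andP[vT vH].
have N3 := degree_ge3 vH vT; set N := [set u | _] in N3.
have on_route e q : e \in edges H -> is_route q (route q) -> essential e q (route q) ->
    e \in walk_edges q.1 (route q).
  by move=> _ [[rq _] lq _] ess; apply: ess.
have [u0 u0N] : exists u0, u0 \in N by apply/set0Pn; rewrite -card_gt0; lia.
rewrite inE in u0N; have [p [pP pr pe]] := routeP _ u0N.
have vp : v \in p.1 :: route p.
  by apply: walk_edges_mem (on_route _ _ u0N pr pe) _; rewrite set21.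
have [u [w [uw uv vw vedges]]] := route_inner pP pr vT vp.
have [u' u'N u'uw] : exists2 u', u' \in N & u' \notin [set u; w].
  apply/subsetPn; apply: contraTN N3 => /subset_leq_card; rewrite cards2 uw; lia.
rewrite inE in u'N; set f := [set v; u'].
have fp : f \notin walk_edges p.1 (route p).
  apply: contra u'uw => /vedges; rewrite set21 !inE => /(_ isT).
  by case=> /set2_inj[][E1 E2]; apply/orP; [left|left|right|right]; apply/eqP; congruence.
have [q [qP qr qe]] := routeP _ u'N.
apply/bigcupP; exists p => //; apply/bigcupP; exists q => //.
have [[rq _] lq uq] := qr; have [pr1 _ _] := pr.
have := on_route _ _ u'N qr qe => /walk_edges_split[p1 [b [p2 [E fE]]]].
have vf : v \in f by rewrite set21.
have uf : u' \in f by rewrite set22.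
have bf : b \in f by rewrite /f fE set22.
(* If [route q] met [route p] again beyond the edge [f], the piece of [route q]
   through [f] could be replaced by a piece of [route p], which avoids [f]. *)
have reroute r1 r2 r3 z t : route q = r1 ++ r2 ++ r3 -> last q.1 r1 = z ->
    last z r2 = t -> z \in p.1 :: route p -> t \in p.1 :: route p ->
    f \notin walk_edges q.1 r1 -> f \notin walk_edges t r3 -> False.
  move=> Er lz lt zp tp f1 f3.
  have [s [es ls subs smin]] := shortest_segment (@adj_sym _ H) pr1 zp tp.
  have := qe (r1 ++ s ++ r3); move: rq lq.
  rewrite Er !cat_path !last_cat !walk_length_cat !walk_edges_cat !mem_cat lz lt ls.
  move=> /and3P[e1 e2 e3] l3; rewrite e1 es e3 (negPf f1) (negPf f3) orbF.
  rewrite lerD2l lerD2r => /(_ isT l3 (smin _ e2 lt)) /subs.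
  exact/negP.
rewrite /F /common E -cat_cons filter_cat.
have uq' : uniq ((q.1 :: p1) ++ b :: p2) by move: uq; rewrite E.
have dis a : a \in q.1 :: p1 -> a \in b :: p2 -> False.
  by move: uq'; rewrite cat_uniq => /and3P[_ /hasPn d _] h /d /=; rewrite h.
have [lv|lv] := eqVneq (last q.1 p1) v.
  have -> : [seq z <- b :: p2 | z \in p.1 :: route p] = [::].
    apply/eqP; rewrite -(negbK (_ == _)) -has_filter; apply/hasPn => t tb; apply/negP=> tp.
    have [r1 [r2 [E2 lt]]] : exists r1 r2, b :: p2 = r1 ++ r2 /\ last v r1 = t.
      by apply: mem_split; rewrite inE tb orbT.
    apply: (reroute p1 r1 r2 v t) => //; first by rewrite E E2.
      apply/negP=> /walk_edges_mem /(_ bf) bp.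
      by apply: dis bp _; rewrite mem_head.
    apply/negP=> /walk_edges_mem /(_ vf) vt.
    apply: (dis v); first by rewrite -lv mem_last.
    rewrite E2; move: vt; rewrite inE => /orP[/eqP vt|vt]; last by rewrite mem_cat vt orbT.
    by move: tb; rewrite -vt E2.
  rewrite cats0 (lastI q.1 p1) filter_rcons lv vp last_rcons.
  exact: set22.
have [lu' bv] : last q.1 p1 = u' /\ b = v.
  by case: (set2_inj fE) => -[E1 E2]; [rewrite -E1 eqxx in lv|].
subst b.
have -> : [seq z <- q.1 :: p1 | z \in p.1 :: route p] = [::].
  apply/eqP; rewrite -(negbK (_ == _)) -has_filter; apply/hasPn => t tb; apply/negP=> tp.
  have [r1 [r2 [E2 lt]]] := mem_split tb.
  have vq : v \notin q.1 :: p1 by apply/negP=> /dis; apply; rewrite mem_head.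
  apply: (reroute r1 (r2 ++ [:: v]) p2 t v) => //.
  - by rewrite E E2 -!catA.
  - by rewrite last_cat.
  - apply/negP=> /walk_edges_mem /(_ vf) vt.
    by case/negP: vq; rewrite E2 -cat_cons mem_cat vt.
  - apply/negP=> /walk_edges_mem /(_ uf).
    by apply: dis; rewrite -lu' mem_last.
by rewrite cat0s /= vp /= set21.
Qed.

End Minimal.
End Preserving.

(** * Distances as infima, and the size bound *)

Section Distances.
Variables (R : realType) (V : finType).

Lemma dist_le_within (G : sgraph V) (ell : {set V} -> R) L x y :
  within ell (adj G) L x y -> (dist G ell x y <= L%:E)%E.
Proof.
case=> p [ep lp wp]; apply: (@le_trans _ _ (walk_length ell x p)%:E).
  by apply: ereal_inf_lbound; exists p.
by rewrite lee_fin.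
Qed.

Lemma dist_ge (G : sgraph V) (ell : {set V} -> R) x y (d : \bar R) :
  (forall L, within ell (adj G) L x y -> (d <= L%:E)%E) -> (d <= dist G ell x y)%E.
Proof.
move=> H; apply/ereal_infP => _ [p [ep lp ->]]; apply: H.
by exists p.
Qed.

End Distances.

Lemma soft_quadratic (R : realType) (c : nat) :
  soft_bigO R (fun k => 2 * (c * (2 * ((4 + trunc_log 2 k) * k))) ^ 2)%N
              (fun k => (k ^ 2)%N).
Proof.
exists (200 * c%:R ^+ 2 / ln 2 ^+ 2), 2%N => k k2.
have ln2 : 0 < ln (2 : R) by rewrite ln_gt0 // ltr1n.
have lnk : ln (2 : R) <= ln k%:R by rewrite ler_ln ?posrE ?ltr0n ?ler_nat //; lia.
have tk : (trunc_log 2 k)%:R * ln 2 <= ln (k%:R : R).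
  rewrite mulr_natl -lnXn // ler_ln ?posrE ?exprn_gt0 ?ltr0n //; last by lia.
  by rewrite -natrX ler_nat trunc_logP //; lia.
have t5 : (4 + trunc_log 2 k)%:R <= 5 * (ln k%:R / ln 2) :> R.
  rewrite mulrA ler_pdivlMr // natrD mulrDl; lra.
set t := (4 + _)%N in t5 *.
have t2 : t%:R ^+ 2 <= 25 * (ln k%:R / ln 2) ^+ 2 :> R.
  have -> : 25 = 5 ^+ 2 :> R by rewrite -natrX.
  rewrite -exprMn lerXn2r ?nnegrE ?ler0n //.
  exact: le_trans t5.
have -> : 200 * c%:R ^+ 2 / ln 2 ^+ 2 * (k ^ 2)%:R * ln k%:R ^+ 2
    = (8 * (c ^ 2 * k ^ 2)%:R) * (25 * (ln k%:R / ln 2) ^+ 2) :> R.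
  by rewrite natrM !natrX expr_div_n; field; rewrite gt_eqF.
apply: le_trans (ler_wpM2l _ t2); last by rewrite mulr_ge0.
rewrite -natrX -!natrM ler_nat; apply: eq_leq; ring.
Qed.

Theorem theorem5p4 (R : realType) (W : finType) (M : sgraph W) :
  exists (alpha : R) (y : nat -> nat),
    [/\ (1 <= alpha)%R,
        soft_bigO R y (fun k => (k ^ 2)%N) &
        forall (V : finType) (G : sgraph V) (ell : {set V} -> R) (T : {set V}),
          positive_lengths G ell ->
          T \subset verts G ->
          excludes_minor G M ->
          exists (H : sgraph V) (ell' : {set V} -> R),
            is_sized_DAM G ell T alpha (y #|T|) H ell'].
Proof.
set r := #|W|.+2.
exists (12 * (17 + 12 * r%:R)),
  (fun k => 2 * (2 ^ r * r * (2 * ((4 + trunc_log 2 k) * k))) ^ 2)%N.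
have r0 : 0 <= r%:R :> R by apply: ler0n.
split; [lra|exact: soft_quadratic|move=> V G ell T pos TG GM].
have [P [PT cardP spanner]] := spanner_exists T pos GM.
have G_pos : pos_rel ell (adj G) by move=> x y; apply: pos.
have [H [len [HP Hmin]]] := minimal_preserving T P G_pos.
have [GH H_pos HG GHP] := HP.
exists H, len; split; last first.
  apply: leq_trans (vertices_bound PT HP Hmin) _.
  by rewrite leq_mul2l leq_sqr cardP orbT.
split=> //.
  by move=> e /[dup] eH /edgeP[x [y [E _ _ _]]]; rewrite E in eH *; apply: H_pos.
move=> x y xT yT; split.
  by apply: dist_ge => L w; apply: dist_le_within; apply: HG.
set alpha := 12 * _.
have alpha0 : 0 < alpha by rewrite /alpha; lra.
rewrite -lee_pdivrMl //; apply: dist_ge => L w; rewrite lee_pdivrMl // -EFinM.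
apply: dist_le_within; move: x y L xT yT w.
apply: (spanner (within len (adj H))).
- by move=> L1 L2 x y; apply: within_le.
- by move=> L x; apply: within_refl.
- by move=> L x y; apply: within_sym; apply: adj_sym.
- by move=> L1 L2 y x z; apply: within_trans.
- exact: GHP.
Qed.
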